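(* Let $n$ be a positive integer and let $S$ be a reduced colour sequence with colours in $\{a_ib_k:0\le i,k\le n-1\}$. Then $$\sum_{\lambda\in\mathcal{P}_n:\ \ker(\lambda)=S}q^{|\lambda|}=\sum_{F\in\mathcal{F}_n:\ \ker(F)=S}q^{|F|}.$$
   Context: Colours are symbols $a_ib_k$ ($0\le i,k\le n-1$); $a_ib_i$ is free. With $\chi(P)\in\{0,1\}$ the truth value of $P$, $\Delta(a_ib_k,a_{i'}b_{k'})=\chi(i\ge i')-\chi(i=k=i')+\chi(k\le k')-\chi(k=i'=k')$. $\mathcal{P}_n$ is the set of coloured partitions $\lambda_1+\dots+\lambda_s$ (positive integer parts, colours $c(\lambda_j)$) with $\lambda_j-\lambda_{j+1}\ge\Delta(c(\lambda_j),c(\lambda_{j+1}))$; $|\lambda|=\sum\lambda_j$; its colour sequence is $c(\lambda_1),\dots,c(\lambda_s)$. $\mathcal{F}_n$ is the set of $n^2$-coloured Frobenius partitions: arrays $F=\begin{pmatrix}\lambda_1&\cdots&\lambda_s\\ \mu_1&\cdots&\mu_s\end{pmatrix}$ with $\lambda_1>\dots>\lambda_s$ non-negative integers coloured by symbols $a_i$, strictly decreasing for the order $0_{a_{n-1}}<\dots<0_{a_0}<1_{a_{n-1}}<\dots<1_{a_0}<\cdots$, and $\mu_1>\dots>\mu_s$ non-negative integers coloured by symbols $b_i$, strictly decreasing for $0_{b_0}<\dots<0_{b_{n-1}}<1_{b_0}<\cdots$; $|F|=s+\sum\lambda_j+\sum\mu_j$; its colour sequence is $c(\lambda_1)c(\mu_1),\dots,c(\lambda_s)c(\mu_s)$.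 Reduction of a colour sequence: repeatedly apply, as long as possible, the operations (1) if some $c_i=a_kb_\ell$ and $c_{i+1}=a_\ell b_\ell$, remove $c_{i+1}$; (2) if some $c_i=a_kb_k$ and $c_{i+1}=a_kb_\ell$, remove $c_i$ (here $k=\ell$ is allowed). The final sequence (independent of the order of operations) is the reduction; a sequence equal to its reduction is reduced. The kernel $\ker$ of a coloured partition or of a Frobenius partition is the reduction of its colour sequence. *)

(* Defs.v *)
From mathcomp Require Import all_boot all_order all_algebra finmap.
From mathcomp Require Import classical_sets cardinality.
From Stdlib Require Import Relation_Operators.

Set Implicit Arguments.
Unset Strict Implicit.
Unset Printing Implicit Defensive.

Import Order.TTheory GRing.Theory Num.Theory.
Local Open Scope ring_scope.

(* The colour a_i b_k is the pair (i, k). *)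
Definition colour (n : nat) := ('I_n * 'I_n)%type.

Section Definitions.
Variable n : nat.
Implicit Types (c : colour n) (w u v : seq (colour n)).

Definition free c : bool := c.1 == c.2.

Definition chi (b : bool) : int := (nat_of_bool b)%:Z.

Definition Delta c c' : int :=
  let: (i, k) := c in
  let: (i', k') := c' in
  chi (i' <= i)%N - chi ((i == k) && (k == i'))
  + chi (k <= k')%N - chi ((k == i') && (i' == k')).

(* A part is a pair (value, colour); parts are listed as lambda_1, lambda_2, ... *)
Definition cpart : Type := seq (nat * colour n).

Definition in_P (lam : cpart) : bool :=
  all (fun p => 0 < p.1)%N lam
  && sorted (fun p p' => Delta p.2 p'.2 <= p.1%:Z - p'.1%:Z) lam.

Definition P_weight (lam : cpart) : nat := (\sum_(p <- lam) p.1)%N.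

Definition P_colours (lam : cpart) : seq (colour n) := unzip2 lam.

(* A Frobenius array is the list of its columns; an entry is (value, index of
   its colour), the colour being a_i in the top row and b_i in the bottom row. *)
Definition farray : Type := seq ((nat * 'I_n) * (nat * 'I_n)).

Definition a_lt (p p' : nat * 'I_n) : bool :=
  (p.1 < p'.1)%N || (p.1 == p'.1) && (p'.2 < p.2)%N.

Definition b_lt (p p' : nat * 'I_n) : bool :=
  (p.1 < p'.1)%N || (p.1 == p'.1) && (p.2 < p'.2)%N.

Definition in_F (F : farray) : bool :=
  sorted (fun p p' => a_lt p' p) (unzip1 F)
  && sorted (fun p p' => b_lt p' p) (unzip2 F).

Definition F_weight (F : farray) : nat :=
  (size F + \sum_(p <- unzip1 F) p.1 + \sum_(p <- unzip2 F) p.1)%N.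

Definition F_colours (F : farray) : seq (colour n) :=
  [seq (col.1.2, col.2.2) | col <- F].

Inductive red_step : seq (colour n) -> seq (colour n) -> Prop :=
| RedRight w1 w2 (k l : 'I_n) :
    red_step (w1 ++ (k, l) :: (l, l) :: w2) (w1 ++ (k, l) :: w2)
| RedLeft w1 w2 (k l : 'I_n) :
    red_step (w1 ++ (k, k) :: (k, l) :: w2) (w1 ++ (k, l) :: w2).

(* The leftmost available operation; the identity if there is none. *)
Fixpoint red1 w : seq (colour n) :=
  if w is c :: w1 then
    if w1 is c' :: w2 then
      if free c' && (c.2 == c'.1) then c :: w2
      else if free c && (c.2 == c'.1) then w1
      else c :: red1 w1
    else w
  else w.

(* [reductionP] below: this does not depend on the order of the operations. *)
Definition reduction w : seq (colour n) := iter (size w) red1 w.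

Definition reduced w : Prop := w = reduction w.

Definition P_ker (lam : cpart) := reduction (P_colours lam).
Definition F_ker (F : farray) := reduction (F_colours F).

Local Notation red_steps := (clos_refl_trans_1n _ red_step).

Lemma red_step_size w u : red_step w u -> size w = (size u).+1.
Proof. by case=> w1 w2 k l; rewrite !size_cat /= !addnS. Qed.

Lemma red_step_cons c w u : red_step w u -> red_step (c :: w) (c :: u).
Proof.
case=> w1 w2 k l; first exact: (RedRight (c :: w1)).
exact: (RedLeft (c :: w1)).
Qed.

Lemma red1P w : red1 w = w \/ red_step w (red1 w).
Proof.
elim: w => [|[i k] [|[i' k'] w] IH]; [by left | by left |].
rewrite [red1 _]/= /free /=.
case: ifP => [/andP[/eqP-> /eqP->]|_]; first by right; exact: (RedRight [::]).
case: ifP => [/andP[/eqP-> /eqP->]|_]; first by right; exact: (RedLeft [::]).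
case: IH => [E|E]; first by left; congr cons.
by right; exact: red_step_cons.
Qed.


Lemma red_step_inv c w u : red_step (c :: w) u ->
  (exists c' w2, [/\ w = c' :: w2, c.2 = c'.1 &
     (free c' /\ u = c :: w2) \/ (free c /\ u = w)])
  \/ exists2 u', u = c :: u' & red_step w u'.
Proof.
move E: (c :: w) => cw H; case: cw u / H E => [[|x w1]|[|x w1]] w2 k l [-> ->].
- by left; exists (l, l), w2; split => //; left; rewrite /free eqxx.
- by right; exists (w1 ++ (k, l) :: w2) => //; exact: RedRight.
- by left; exists (k, l), w2; split => //; right; rewrite /free eqxx.
- by right; exists (w1 ++ (k, l) :: w2) => //; exact: RedLeft.
Qed.

Lemma red_step_right c c' w : free c' -> c.2 = c'.1 ->
  red_step (c :: c' :: w) (c :: w).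
Proof.
case: c c' => [i k] [i' k']; rewrite /free /= => /eqP <- ->.
exact: (RedRight [::]).
Qed.

Lemma red_step_left c c' w : free c -> c.2 = c'.1 ->
  red_step (c :: c' :: w) (c' :: w).
Proof.
case: c c' => [i k] [i' k']; rewrite /free /= => /eqP -> ->.
exact: (RedLeft [::]).
Qed.

Lemma free_eq c c' : free c -> free c' -> c.2 = c'.1 -> c = c'.
Proof. by case: c c' => [i k] [i' k']; rewrite /free /= => /eqP-> /eqP <- ->. Qed.

Lemma red_step_diamond w u v : red_step w u -> red_step w v ->
  u = v \/ exists2 z, red_step u z & red_step v z.
Proof.
elim: w u v => [|c w IH] u v.
  by move=> /red_step_size.
have aux c' w2 u1 v' : w = c' :: w2 -> c.2 = c'.1 ->
    (free c' /\ u1 = c :: w2) \/ (free c /\ u1 = w) -> red_step w v' ->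
    u1 = c :: v' \/ exists2 z, red_step u1 z & red_step (c :: v') z.
  move=> -> ec hu /red_step_inv[[c'' [w3 [ew ec' hv]]]|[v2 -> hv]].
    case: hu hv; rewrite ew => -[f1 ->] [[f ->]|[f ->]].
    - by left; rewrite (free_eq f1 f ec').
    - by left.
    - by right; exists (c' :: w3);
        [exact: red_step_right | exact: red_step_left].
    - by left; rewrite (free_eq f1 f ec).
  case: hu => [[fc' ->]|[fc ->]]; right.
    by exists (c :: v2); [exact: red_step_cons | exact: red_step_right].
  by exists (c' :: v2); [exact: red_step_cons | exact: red_step_left].
move=> /red_step_inv[[c1 [w1 [e1 ec1 hu]]]|[u' -> hu]]
       /red_step_inv[[c2 [w2 [e2 ec2 hv]]]|[v' -> hv]].
- move: e2 ec2 hv; rewrite e1 => -[<- <-] _ hv; rewrite e1 in hu.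
  left; case: hu hv => [[f1 ->]|[f1 ->]] [[f2 ->]|[f2 ->]] //.
    by rewrite (free_eq f2 f1 ec1).
  by rewrite (free_eq f1 f2 ec1).
- exact: aux e1 ec1 hu hv.
- have [->|[z hz1 hz2]] := aux _ _ _ _ e2 ec2 hv hu; first by left.
  by right; exists z.
- have [->|[z hz1 hz2]] := IH _ _ hu hv; first by left.
  by right; exists (c :: z); exact: red_step_cons.
Qed.

Lemma red1_normal w u : red1 w = w -> ~ red_step w u.
Proof.
elim: w u => [|c w IH] u; first by move=> _ /red_step_size.
move=> e /red_step_inv[[c' [w2 [ew ec h]]]|[u' _ h]]; last first.
  case: w e IH h => [|c' w2] e IH h; first by move/red_step_size: h.
  move: e => /=; case: ifP => _; first by move/(congr1 size)/eqP; rewrite /= ltn_eqF.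
  case: ifP => _; first by move/(congr1 size)/eqP; rewrite /= ltn_eqF.
  by move=> [] /IH /(_ h).
move: e; rewrite ew /= ec eqxx !andbT.
case: ifP => [_ /(congr1 size)/eqP|nf']; first by rewrite /= ltn_eqF.
case: ifP => [_ /(congr1 size)/eqP|nf]; first by rewrite /= ltn_eqF.
by case: h => -[]; rewrite ?nf ?nf'.
Qed.

Lemma red1_reduction w : red1 (reduction w) = reduction w.
Proof.
suff H m : (size (iter m red1 w) <= size w - m)%N \/
    red1 (iter m red1 w) = iter m red1 w.
  by case: (H (size w)) => //; rewrite subnn leqn0 -/(reduction w) => /nilP ->.
elim: m => [|m [IH|IH]]; first by left; rewrite subn0.
  have [e|h] := red1P (iter m red1 w); first by right; rewrite iterS !e.
  by left; rewrite iterS subnS; move: IH; rewrite (red_step_size h); case: subn.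
by right; rewrite iterS !IH.
Qed.

Lemma red_steps_reduction w : red_steps w (reduction w).
Proof.
rewrite /reduction; move: (size w) => m; elim: m w => [|m IH] w; first exact: rt1n_refl.
rewrite iterSr; have [->|h] := red1P w; first exact: IH.
exact: rt1n_trans h (IH _).
Qed.

(* The reduction is the unique final sequence, whatever the order of the
   operations. *)
Lemma reductionP w u :
  reduction w = u <-> red_steps w u /\ (forall v, ~ red_step u v).
Proof.
split=> [<-|[]].
  split; first exact: red_steps_reduction.
  by move=> v; apply: red1_normal; exact: red1_reduction.
move: (red_steps_reduction w) => h1 h2 nu.
have n1 v : ~ red_step (reduction w) v.
  by apply: red1_normal; exact: red1_reduction.
move: (reduction w) h1 n1 => r h1 n1.
elim: {w}(size w) {-2}w (leqnn (size w)) r u h1 h2 n1 nu => [|m IH] w sw r u h1 h2 n1 nu.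
  case: h1 n1 h2 => [|y z h]; last by move: sw; rewrite (red_step_size h).
  by move=> _; case => // y z h; move: sw; rewrite (red_step_size h).
case: h1 n1 h2 nu => [|y r' hy hr] n1.
  by case=> // y z h; have := n1 _ h.
case=> [|z u' hz hu] nu; first by have := nu _ hy.
have le x : red_step w x -> (size x <= m)%N.
  by move=> /red_step_size e; move: sw; rewrite e.
have [e|[x hyx hzx]] := red_step_diamond hy hz.
  by rewrite -e in hu; exact: (IH y (le _ hy)).
have nx v : ~ red_step (reduction x) v.
  by apply: red1_normal; exact: red1_reduction.
have sx := red_steps_reduction x.
rewrite (IH y (le _ hy) r' (reduction x)) //; last exact: rt1n_trans hyx sx.
by apply: (IH z (le _ hz)) => //; exact: rt1n_trans hzx sx.
Qed.

End Definitions.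

(* The formal power series \sum_(x in A) q ^ (wt x) is well defined when each
   exponent is attained finitely often; it is encoded by its coefficients. *)
Definition summable_gf (T : choiceType) (A : set T) (wt : T -> nat) : Prop :=
  forall m : nat, finite_set [set x | A x /\ wt x = m]%classic.

Definition gf (T : choiceType) (A : set T) (wt : T -> nat) (m : nat) : nat :=
  #|` fset_set [set x | A x /\ wt x = m]%classic|%fset.

(* Main.v *)
(* Read colour sequences from the right and let q be an indeterminate.  For a
   word of length p, the coloured partitions with that colour sequence have
   generating function q^e / (q)_p and the Frobenius partitions q^e' / (q)_p^2,
   where e and e' accumulate the forced differences; so the generating functions
   by length of all words with a given kernel obey linear recurrences in p.
   Words with kernel S arise from S by inserting runs of free colours, and
   solving the recurrences one letter of S at a time shows that both families
   have the same coefficients c_s, with respect to the basis q^p / (q)_{p-s} for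
   P_n and q^s q^{p(p-s)} / ((q)_p (q)_{p-s}) for F_n.  Summed over p, both basis
   elements give q^s / (q)_oo: the first by telescoping, the second by the
   Durfee rectangle identity.  The argument is carried out in the field of
   fractions of Q[q], modulo q^N for every N. *)
From Stdlib Require Import Relation_Operators.
From mathcomp Require Import all_boot all_order all_algebra finmap.
From mathcomp Require Import classical_sets cardinality.
From mathcomp Require Import ring zify.
Require Import Defs.

Set Implicit Arguments.
Unset Strict Implicit.
Unset Printing Implicit Defensive.

Import GRing.Theory.
Local Open Scope ring_scope.

(** * The two families of basis sequences *)

Ltac nonzero := do ?[apply/andP; split]; rewrite ?oner_neq0 //.

Section Kernels.
Variables (K : fieldType) (q : K).
Hypothesis q_neq0 : q != 0.
Hypothesis q_aper : forall p, 1 - q ^+ p.+1 != 0.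

Definition qfact m : K := \prod_(i < m) (1 - q ^+ i.+1).

(* Basis sequences, indexed by the length p, in which the generating functions
   of the words with a given kernel are expanded for P_n (TP) and F_n (TF). *)
Definition TP p s : K := if (s <= p)%N then (qfact (p - s))^-1 else 0.

Definition TF p s : K :=
  if (s <= p)%N then q ^+ (p * (p - s)) / (qfact p * qfact (p - s)) else 0.

Lemma qfact_neq0 m : qfact m != 0.
Proof. by apply/prodf_neq0 => i _; exact: q_aper. Qed.

Lemma qfactS m : qfact m.+1 = qfact m * (1 - q ^+ m.+1).
Proof. by rewrite /qfact big_ord_recr. Qed.

Lemma qfact0 : qfact 0 = 1.
Proof. by rewrite /qfact big_ord0. Qed.

Lemma qX_neq0 m : q ^+ m != 0.
Proof. by rewrite expf_neq0. Qed.

Lemma TP_gt p s : (p < s)%N -> TP p s = 0.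
Proof. by rewrite ltnNge /TP => /negbTE->. Qed.

Lemma TF_gt p s : (p < s)%N -> TF p s = 0.
Proof. by rewrite ltnNge /TF => /negbTE->. Qed.

Lemma TPD s r : TP (s + r) s = (qfact r)^-1.
Proof. by rewrite /TP leq_addr addKn. Qed.

Lemma TFD s r :
  TF (s + r) s = q ^+ s ^+ r * q ^+ (r * r) / (qfact (s + r) * qfact r).
Proof. by rewrite /TF leq_addr addKn mulnDl exprD exprM. Qed.

Lemma TPnn p : TP p p = 1.
Proof. by rewrite /TP leqnn subnn qfact0 invr1. Qed.

Lemma TFnn p : TF p p = (qfact p)^-1.
Proof. by rewrite /TF leqnn subnn muln0 expr0 qfact0 mulr1 div1r. Qed.

Lemma TP0 s : TP 0 s = (s == 0%N)%:R.
Proof. by case: s => [|s]; rewrite /TP //= qfact0 invr1. Qed.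

Lemma TF0 s : TF 0 s = (s == 0%N)%:R.
Proof.
by case: s => [|s]; rewrite /TF //= qfact0 !mulr1 divr1.
Qed.

Lemma TP_rec p s : (1 - q ^+ p.+1) * TP p.+1 s.+1 =
  TP p s.+1 + q ^+ p * ((1 - q ^+ s.+1) / q ^+ s) * TP p s.
Proof.
case: (ltngtP p s) => [lt_ps|lt_sp|->].
- by rewrite !TP_gt ?mulr0 ?addr0 // ltnW.
- have [r ->] : exists r, p = (s.+1 + r)%N by exists (p - s.+1)%N; rewrite subnKC.
  rewrite -[(s.+1 + r).+1]addnS !TPD (addSnnS s r) TPD !qfactS.
  have := qX_neq0 s; have := q_aper r; have := qfact_neq0 r.
  by rewrite !(exprS, exprD); intros; field; apply/and3P.
- rewrite (TP_gt (ltnSn s)) !TPnn.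
  by have := qX_neq0 s; rewrite exprS; intros; field.
Qed.

Lemma TP_rec0 p : (1 - q ^+ p.+1) * TP p.+1 0 = TP p 0.
Proof.
rewrite /TP /= !subn0 qfactS.
by have := q_aper p; have := qfact_neq0 p; intros; field; apply/andP.
Qed.

Lemma TP_diff p s : TP p.+1 s - TP p s = q ^+ p.+1 / q ^+ s * TP p.+1 s.
Proof.
case: (ltngtP s p.+1) => [lt_sp|lt_ps|->].
- have [r ->] : exists r, p = (s + r)%N by exists (p - s)%N; rewrite subnKC.
  rewrite -addnS !TPD qfactS addnS !exprS !exprD.
  have := qX_neq0 s; have := q_aper r; have := qfact_neq0 r.
  by rewrite !exprS; intros; field; apply/and3P.
- by rewrite !TP_gt ?mulr0 ?subr0 // ltnW.
- by rewrite (TP_gt (ltnSn p)) subr0 divff ?mul1r // qX_neq0.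
Qed.

(** Like [TF_scale] below, trades a power of $q^p$ for one of $q^s$ at the price of a term of index
    s+1; [Inv_secondary] needs both to remove leftover powers of $q^p$. *)
Lemma TP_scale p s : q ^+ p * TP p s = q ^+ s * (TP p s - TP p s.+1).
Proof.
case: (ltngtP s p) => [lt_sp|lt_ps|->].
- have [r ->] : exists r, p = (s.+1 + r)%N by exists (p - s.+1)%N; rewrite subnKC.
  rewrite TPD (addSnnS s r) TPD qfactS !exprS !exprD !exprS.
  have := qX_neq0 s; have := q_aper r; have := qfact_neq0 r.
  by rewrite !exprS; intros; field; apply/andP.
- by rewrite !TP_gt ?mulr0 ?subr0 ?mulr0 // ltnW.
- by rewrite (TP_gt (ltnSn p)) subr0.
Qed.

(** The factor $(1-q^{s+1})/q^s$ before [TF p s] is the one in [TP_rec]; this coincidence lets one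
    list of coefficients serve both families. *)
Lemma TF_rec p s : (1 - q ^+ p.+1) ^+ 2 * TF p.+1 s.+1 =
  q ^+ p * q ^+ p.+1 * TF p s.+1 + q ^+ p * ((1 - q ^+ s.+1) / q ^+ s) * TF p s.
Proof.
case: (ltngtP p s) => [lt_ps|lt_sp|->].
- by rewrite !TF_gt ?mulr0 ?addr0 // ltnW.
- have [r ->] : exists r, p = (s.+1 + r)%N by exists (p - s.+1)%N; rewrite subnKC.
  rewrite -[(s.+1 + r).+1]addnS !TFD (addSnnS s r) TFD addSn addnS !qfactS.
  have := qX_neq0 s; have := q_aper r; have := qfact_neq0 r.
  have := q_aper (s + r); have := qfact_neq0 (s + r).
  have := q_aper (s + r).+1.
  have -> : (r.+1 * r.+1 = r * r + r + r + 1)%N by ring.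
  rewrite !(exprS, exprD, expr0, exprMn); intros; field.
  by do ?[apply/andP; split].
- rewrite (TF_gt (ltnSn s)) !TFnn qfactS mulr0 add0r.
  have := qX_neq0 s; have := q_aper s; have := qfact_neq0 s.
  by rewrite exprS; intros; field; apply/and3P.
Qed.

Lemma TF_rec0 p :
  (1 - q ^+ p.+1) ^+ 2 * TF p.+1 0 = q ^+ p * q ^+ p.+1 * TF p 0.
Proof.
rewrite /TF /= !subn0 qfactS.
have := q_aper p; have := qfact_neq0 p.
have -> : (p.+1 * p.+1 = p * p + p + p + 1)%N by ring.
rewrite !(exprS, exprD, expr0); intros; field.
by apply/andP.
Qed.

Lemma TF_diff p s : (1 - q ^+ p.+1) * TF p.+1 s + q ^+ p * TF p s =
  (1 - q ^+ p.+1) * (q ^+ s / q ^+ p.+1) * TF p.+1 s.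
Proof.
case: (ltngtP s p.+1) => [lt_sp|lt_ps|->].
- have [r ->] : exists r, p = (s + r)%N by exists (p - s)%N; rewrite subnKC.
  rewrite -addnS !TFD !addnS !qfactS.
  have := qX_neq0 s; have := q_aper r; have := qfact_neq0 r.
  have := q_aper (s + r); have := qfact_neq0 (s + r).
  have := qX_neq0 r.
  have -> : (r.+1 * r.+1 = r * r + r + r + 1)%N by ring.
  rewrite !(exprS, exprD, expr0); intros; field.
  by do ?[apply/andP; split].
- by rewrite !TF_gt ?mulr0 ?addr0 // ltnW.
- by rewrite (TF_gt (ltnSn p)) mulr0 addr0 divff ?mulr1 // qX_neq0.
Qed.

Lemma TF_scale p s : TF p s = q ^+ p * (TF p s / q ^+ s + TF p s.+1).
Proof.
case: (ltngtP s p) => [lt_sp|lt_ps|->].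
- have [r ->] : exists r, p = (s.+1 + r)%N by exists (p - s.+1)%N; rewrite subnKC.
  rewrite TFD (addSnnS s r) TFD addnS !qfactS.
  have := qX_neq0 s; have := q_aper r; have := qfact_neq0 r.
  have := q_aper (s + r); have := qfact_neq0 (s + r).
  have -> : (r.+1 * r.+1 = r * r + r + r + 1)%N by ring.
  rewrite !(exprS, exprD, expr0, exprMn); intros; field.
  by do ?[apply/andP; split].
- by rewrite !TF_gt ?mul0r ?addr0 ?mulr0 // ltnW.
- by rewrite (TF_gt (ltnSn p)) addr0 mulrC divfK // qX_neq0.
Qed.
(** Inverse of the factor common to [TP_rec] and [TF_rec]: multiplying a coefficient by [mu s] while
    raising its index to s+1 solves both recurrences at once ([TP_mu], [TF_mu]). *)
Definition mu s : K := q ^+ s / (1 - q ^+ s.+1).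

Lemma mu_shift s : mu s * q ^+ s.+1 = mu s - q ^+ s.
Proof. by rewrite /mu; have := q_aper s; intros; field. Qed.

Lemma TP_mu p s : (1 - q ^+ p.+1) * (mu s * TP p.+1 s.+1) =
  mu s * TP p s.+1 + q ^+ p * TP p s.
Proof.
rewrite mulrCA TP_rec /mu; have := q_aper s; have := qX_neq0 s.
by intros; field; apply/andP.
Qed.

Lemma TF_mu p s : (1 - q ^+ p.+1) ^+ 2 * (mu s * TF p.+1 s.+1) =
  q ^+ p * q ^+ p.+1 * (mu s * TF p s.+1) + q ^+ p * TF p s.
Proof.
rewrite mulrCA TF_rec /mu; have := q_aper s; have := qX_neq0 s.
by intros; field; apply/andP.
Qed.

Lemma TP_pred p s : TP p s = (1 - q ^+ p.+1 / q ^+ s) * TP p.+1 s.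
Proof. by rewrite mulrBl mul1r -TP_diff; ring. Qed.

(** Eliminates [TP p s.+1] between [TP_mu] and [TP_pred], so that the terms of length p and index s
    or s+1 all become multiples of [TP p.+1 s.+1]. *)
Lemma TP_pred2 p s : TP p s =
  ((1 - q ^+ p.+1) - (1 - q ^+ p.+1 / q ^+ s.+1)) / q ^+ p * (mu s * TP p.+1 s.+1).
Proof.
apply: (mulfI (qX_neq0 p)); rewrite -[LHS](addKr (mu s * TP p s.+1)) -TP_mu.
rewrite [TP p _]TP_pred; have := qX_neq0 s; have := qX_neq0 p; have := q_neq0.
by rewrite !exprS; intros; field; nonzero.
Qed.

Lemma TF_pred p s : TF p s =
  (1 - q ^+ p.+1) * (q ^+ s / q ^+ p.+1 - 1) / q ^+ p * TF p.+1 s.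
Proof.
apply: (mulfI (qX_neq0 p)).
rewrite -[LHS](addKr ((1 - q ^+ p.+1) * TF p.+1 s)) TF_diff.
by have := qX_neq0 p; have := q_neq0; rewrite !exprS; intros; field; nonzero.
Qed.

Lemma TF_pred2 p s : TF p s = ((1 - q ^+ p.+1) ^+ 2 -
    (1 - q ^+ p.+1) * (q ^+ s.+1 - q ^+ p.+1)) / q ^+ p * (mu s * TF p.+1 s.+1).
Proof.
apply: (mulfI (qX_neq0 p)).
rewrite -[LHS](addKr (q ^+ p * q ^+ p.+1 * (mu s * TF p s.+1))).
rewrite -TF_mu [TF p s.+1]TF_pred.
by have := qX_neq0 p; have := q_neq0; rewrite !exprS; intros; field; nonzero.
Qed.

(** * Summing the basis sequences over p *)

Lemma sum_TP N s : \sum_(p < N.+1) q ^+ p * TP p s = q ^+ s * TP N s.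
Proof.
elim: N => [|N IH].
  by rewrite big_ord1 TP0; case: s => [|s]; rewrite ?mulr0.
rewrite big_ord_recr /= IH.
have -> : TP N s = TP N.+1 s - q ^+ N.+1 / q ^+ s * TP N.+1 s.
  by rewrite -TP_diff; ring.
have := qX_neq0 s; rewrite exprS => ?; by field.
Qed.

(** Generating function of the partitions whose Durfee rectangle of excess s has sides M and M + s;
    it equals [TF p s] for p = M + s. *)
Definition durfee s M : K := q ^+ (M * (M + s)) / (qfact M * qfact (M + s)).

Lemma sum_TF N s : (s <= N)%N ->
  \sum_(p < N.+1) TF p s = \sum_(M < (N - s).+1) durfee s M.
Proof.
move=> le_sN; rewrite -(big_mkord xpredT (TF^~ s)) -(big_mkord xpredT (durfee s)).
have -> : N.+1 = (s + (N - s).+1)%N by rewrite addnS subnKC.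
rewrite (big_cat_nat (n := s)) ?leq_addr //= big_nat.
rewrite big1 ?add0r => [|p /andP[_ lt_ps]].
  rewrite -{1}[s]add0n big_addn addKn; apply: eq_bigr => M _.
  by rewrite /TF leq_addl addnK mulnC mulrC [qfact (M + s) * _]mulrC mulrC.
exact: TF_gt.
Qed.

(* In the limit m -> oo this is the Durfee rectangle identity: the sum over M of
   durfee s M does not depend on s. *)
Lemma durfee_telescope s m :
  \sum_(M < m) (durfee s M - durfee s.+1 M) =
  - ((1 - q ^+ m) * q ^+ (m * (m + s)) / (qfact m * qfact (m + s))).
Proof.
elim: m => [|m IH]; first by rewrite big_ord0 subrr !mul0r oppr0.
rewrite big_ord_recr /= IH /durfee !(addnS, addSn) !qfactS.
have -> : (m * (m + s).+1 = m * (m + s) + m)%N by ring.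
have -> : (m.+1 * (m + s).+1 = m * (m + s) + m + (m + s).+1)%N by ring.
have := qfact_neq0 m; have := qfact_neq0 (m + s).
have := q_aper m; have := q_aper (m + s); rewrite !exprD !exprS !exprD.
by intros; field; nonzero.
Qed.

Lemma inv_qfact_diff m :
  (qfact m)^-1 - (qfact m.+1)^-1 = - (q ^+ m.+1 * (qfact m.+1)^-1).
Proof.
rewrite qfactS; have := qfact_neq0 m; have := q_aper m.
by intros; field; nonzero.
Qed.

End Kernels.

(** * Reduction by a stack *)

Section Stacks.
Variable n : nat.
Implicit Types (c d : colour n) (w z r : seq (colour n)).

(** A stack is a reduced sequence with its last letter on top. Since [nf] folds from the right,
    words z are written last letter first. *)
Definition push c r :=
  if r is d :: r' then
    if free c && (d.2 == c.1) then r
    else if free d && (d.2 == c.1) then c :: r'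
    else c :: r
  else [:: c].

Definition nf z := foldr push [::] z.

Definition irr c d := ~~ ((d.2 == c.1) && (free c || free d)).

Definition diag i : colour n := (i, i).

Lemma free_diag i : free (diag i).
Proof. exact: eqxx. Qed.

Lemma free_diagl c : free c -> c = diag c.1.
Proof. by case: c => i k; rewrite /free /= => /eqP<-. Qed.

Lemma free_diagr c : free c -> c = diag c.2.
Proof. by case: c => i k; rewrite /free /= => /eqP->. Qed.

Lemma push_irr c r : sorted irr r -> sorted irr (push c r).
Proof.
case: r => [|d r] //= srt.
case: ifP => [//|n1]; case: ifP => [/andP[fd /eqP e]|n2]; last first.
  rewrite /= srt andbT /irr; move: n1 n2.
  by case: (d.2 == c.1) => //=; rewrite !andbT => -> ->.
(* The free top d = (j, j) gives way to c, whose first index is j; the letter e' below has second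
   index different from j, so it cannot be reduced with c. *)
case: r srt => [//|e' r] /=; rewrite /irr fd /= andbT => /andP[ne ->].
by move: ne; rewrite (free_diagr fd) /= -e => /negPf->.
Qed.

Lemma nf_irr z : sorted irr (nf z).
Proof. by elim: z => //= c z; apply: push_irr. Qed.

Lemma push_nonnil c r : push c r != [::].
Proof. by case: r => [|d r] //=; case: ifP => // _; case: ifP. Qed.

(** A free letter merging into a free top equals it, so the letter just read is missing from the top
    only if a non-free letter has absorbed it. *)
Lemma push_head c r : sorted irr r ->
  (exists r', push c r = c :: r') \/
  (exists d r', [/\ push c r = d :: r', ~~ free d & c = diag d.2]) .
Proof.
case: r => [|d r] /= srt; first by left; exists [::].
case: ifP => [/andP[fc /eqP e]|n1]; last first.
  by case: ifP => _; left; eexists.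
have [fd|nd] := boolP (free d); last first.
  by right; exists d, r; split => //; rewrite e; exact: free_diagl.
by left; exists r; rewrite (free_diagl fc) -e -free_diagr.
Qed.

(** Source of the recurrence for [Esum]: before c is read, the stack is r, or r topped with the free
    letter that c absorbs (c itself when c is free). *)
Lemma push_eq_head c r t : sorted irr (c :: r) -> sorted irr t ->
  (push c t == c :: r) = (t == r) || (t == diag c.1 :: r).
Proof.
move=> sc st; apply/idP/orP => [|[]/eqP->].
- case: t st => [_ /eqP[<-]|d t] /=; first by left.
  case: ifP => [/andP[fc _] st /eqP->|n1].
    by right; rewrite -free_diagl.
  case: ifP => [/andP[fd /eqP e] _ /eqP[<-]|_ _ /eqP[<-]]; last by left.
  by right; rewrite -e -free_diagr.
- case: r sc => [|d r] //= /andP[ir _]; move: ir; rewrite /irr negb_and negb_or.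
  rewrite ![free _ && _]andbC -negb_or.
  by case: eqP => //= _ /norP[/negPf-> /negPf->].
- rewrite /= eqxx andbT free_diag /=; case: ifP => // fc.
  by rewrite -free_diagl.
Qed.

Lemma push_eq_tail d r t : ~~ free d -> sorted irr (d :: r) ->
  (push (diag d.2) t == d :: r) = (t == d :: r).
Proof.
move=> nd sd; apply/idP/idP => [|/eqP->]; last by rewrite /= free_diag eqxx.
have ne r' : (diag d.2 :: r' == d :: r) = false.
  apply/negP => /eqP[e _]; by move: nd; rewrite -e free_diag.
case: t => [|d' t] /=; rewrite ?ne //.
by case: ifP => // _; case: ifP => _; rewrite ne.
Qed.

Local Notation red_steps := (clos_refl_trans_1n _ (@red_step n)).

Lemma red_steps_trans w1 w2 w3 :
  red_steps w1 w2 -> red_steps w2 w3 -> red_steps w1 w3.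
Proof. by elim=> // x y w hxy _ IH /IH; exact: rt1n_trans. Qed.

Lemma red_steps_rcons c w1 w2 :
  red_steps w1 w2 -> red_steps (rcons w1 c) (rcons w2 c).
Proof.
elim=> [x|x y w hxy _]; first exact: rt1n_refl.
apply: rt1n_trans; case: hxy => u v k l.
  by rewrite !rcons_cat /=; exact: RedRight.
by rewrite !rcons_cat /=; exact: RedLeft.
Qed.

Lemma red_steps_push c r : red_steps (rcons (rev r) c) (rev (push c r)).
Proof.
case: r => [|d r] /=; first exact: rt1n_refl.
rewrite rev_cons -!cats1 -catA /=.
case: ifP => [/andP[fc /eqP e]|_].
  apply: rt1n_trans (rt1n_refl _ _ _); rewrite rev_cons -cats1.
  move: fc e; case: (c) (d) => [i k] [i' k'] /=.
  by rewrite /free /= => /eqP<- ->; exact: (RedRight (rev r) [::]).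
case: ifP => [/andP[fd /eqP e]|_].
  apply: rt1n_trans (rt1n_refl _ _ _); rewrite rev_cons -cats1.
  move: fd e; case: (c) (d) => [i k] [i' k'] /=.
  by rewrite /free /= => /eqP-> ->; exact: (RedLeft (rev r) [::]).
by rewrite !rev_cons -!cats1 -catA; exact: rt1n_refl.
Qed.

Lemma red_steps_nf z : red_steps (rev z) (rev (nf z)).
Proof.
elim: z => [|c z IH] /=; first exact: rt1n_refl.
rewrite rev_cons; apply: red_steps_trans (red_steps_push _ _).
exact: red_steps_rcons.
Qed.

Lemma irr_normal r v : sorted irr r -> ~ red_step (rev r) v.
Proof.
move=> srt; apply: red1_normal.
have: sorted (fun d c => irr c d) (rev r) by rewrite rev_sorted.
elim: (rev r) => [|d [|c w] IH] // /andP[ir sw].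
rewrite -[RHS]/(d :: c :: w) -[in RHS]IH // [LHS]/=.
move: ir; rewrite /irr; case: (_ == _) => /=; last by rewrite !andbF.
by rewrite negb_or => /andP[/negPf-> /negPf->].
Qed.

(** The stack performs the operations in one particular order; by [reductionP] every order has the
    same outcome. *)
Lemma reduction_nf z : reduction (rev z) = rev (nf z).
Proof.
apply/reductionP; split; first exact: red_steps_nf.
by move=> v; apply: irr_normal; exact: nf_irr.
Qed.

Lemma reduced_irr w : reduced w -> sorted irr (rev w).
Proof.
by rewrite /reduced -[w]revK reduction_nf => /(congr1 rev); rewrite !revK => ->;
  exact: nf_irr.
Qed.

End Stacks.

(** * Sums over words with a given kernel *)

Fixpoint seqs (T : Type) (A : seq T) t : seq (seq T) :=
  if t is t'.+1 then [seq a :: s | a <- A, s <- seqs A t'] else [:: [::]].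

Lemma sum_seqsS (R : nmodType) (T : Type) (A : seq T) t (P : pred (seq T))
    (F : seq T -> R) :
  \sum_(s <- seqs A t.+1 | P s) F s =
  \sum_(a <- A) \sum_(s <- seqs A t | P (a :: s)) F (a :: s).
Proof.
rewrite big_mkcond big_allpairs_dep; apply: eq_bigr => a _.
by rewrite [RHS]big_mkcond.
Qed.

Lemma mem_seqs (T : eqType) (A : seq T) t s :
  (s \in seqs A t) = (size s == t) && all [in A] s.
Proof.
elim: t s => [|t IH] [|a s] //=.
  by apply/allpairsP => -[[? ?] []].
rewrite eqSS andbCA -IH.
apply/allpairsP/andP => [[[b u] /= [bA us [-> ->]]]//|[aA sA]].
by exists (a, s).
Qed.

Lemma uniq_seqs (T : eqType) (A : seq T) t : uniq A -> uniq (seqs A t).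
Proof.
move=> uA; elim: t => //= t IH; apply: allpairs_uniq => //.
by move=> [a s] [b u] _ _ /= [-> ->].
Qed.

Section Transfer.
Variables (n : nat) (K : fieldType) (om : nat -> colour n -> colour n -> K).
Implicit Types (c d : colour n) (z r : seq (colour n)).

Definition words t : seq (seq (colour n)) := seqs (index_enum (colour n)) t.

(** Enlarging the gap just after the first p letters raises p parts, so this gap contributes a
    factor depending on p and the two letters beside it. The factor of the smallest part enters only
    in [total_lin]. *)
Fixpoint wweight z : K :=
  if z is c :: z' then
    if z' is d :: _ then wweight z' * om (size z') d c else 1
  else 1.

Definition last_sum c s t : K :=
  \sum_(z <- words t | nf (c :: z) == s) wweight (c :: z).

(** A word with kernel stack c :: r ends in c ([Esum]) or in a free letter absorbed by c ([Lsum]).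
    For free c the two coincide, and [Lsum] is set to 0 to avoid double counting. *)
Definition Esum c r t : K := last_sum c (c :: r) t.

Definition Lsum c r t : K :=
  if free c then 0 else last_sum (diag c.2) (c :: r) t.

Lemma sum_words_head d r t (h : colour n -> K) :
  \sum_(z <- words t.+1 | nf z == d :: r) wweight z * h (head d z) =
  Esum d r t * h d + Lsum d r t * h (diag d.2).
Proof.
rewrite sum_seqsS (bigD1 d) //= mulr_suml; congr (_ + _).
rewrite /Lsum; have [fd|nd] := boolP (free d).
  rewrite mul0r big1 // => c ncd; rewrite big1 // => z /eqP e.
  case: (push_head c (nf_irr z)) => [[r' e']|[d' [r' [e' nf' _]]]].
    by move: e ncd; rewrite /= e' => -[-> _]; rewrite eqxx.
  by move: e nf'; rewrite /= e' => -[-> _]; rewrite fd.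
have nfd : diag d.2 != d by apply: contraNneq nd => <-; exact: free_diag.
rewrite (bigD1 (diag d.2)) //= mulr_suml [X in _ + X]big1 ?addr0 // => c.
case/andP=> ncd ncf; rewrite big1 // => z /eqP e.
case: (push_head c (nf_irr z)) => [[r' e']|[d' [r' [e' _ cE]]]].
  by move: e ncd; rewrite /= e' => -[-> _]; rewrite eqxx.
by move: e cE ncf; rewrite /= e' => -[-> _] ->; rewrite eqxx.
Qed.

Lemma last_sumS c s t : last_sum c s t.+1 =
  \sum_(z <- words t.+1 | push c (nf z) == s)
     wweight z * om t.+1 (head c z) c.
Proof.
rewrite /last_sum !sum_seqsS; apply: eq_bigr => d _.
rewrite big_seq_cond [RHS]big_seq_cond; apply: eq_bigr => z.
by rewrite mem_seqs => /andP[/andP[/eqP<-]].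
Qed.

Lemma head_words c d t z : z \in words t.+1 -> head c z = head d z.
Proof. by rewrite mem_seqs; case: z. Qed.

Lemma sum_words_headE c d r t (h : colour n -> K) :
  \sum_(z <- words t.+1 | nf z == d :: r) wweight z * h (head c z) =
  Esum d r t * h d + Lsum d r t * h (diag d.2).
Proof.
rewrite -sum_words_head big_seq_cond [RHS]big_seq_cond.
by apply: eq_bigr => z /andP[/(head_words c d)-> _].
Qed.

Lemma nf_words_nonnil t z : z \in words t.+1 -> nf z != [::].
Proof. by rewrite mem_seqs; case: z => //= c z _; exact: push_nonnil. Qed.

Lemma Esum0 c r : Esum c r 0 = (r == [::])%:R.
Proof.
rewrite /Esum /last_sum /words /= big_mkcond big_seq1 /= eqseq_cons eqxx.
by rewrite eq_sym; case: eqP.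
Qed.

Lemma Lsum0 c r : Lsum c r 0 = 0.
Proof.
rewrite /Lsum; case: ifPn => // nc.
rewrite /last_sum /words /= big_mkcond big_seq1 /= eqseq_cons; case: eqP => //= e.
by move: nc; rewrite -e free_diag.
Qed.

Lemma LsumS c r t : sorted (@irr n) (c :: r) -> ~~ free c ->
  Lsum c r t.+1 = Esum c r t * om t.+1 c (diag c.2)
                + Lsum c r t * om t.+1 (diag c.2) (diag c.2).
Proof.
move=> sc nc; rewrite {1}/Lsum (negPf nc) last_sumS.
rewrite -(sum_words_headE (diag c.2) _ _ _ (fun d => om t.+1 d (diag c.2))).
by apply: eq_bigl => z; rewrite push_eq_tail.
Qed.

Lemma Esum_split c r t : sorted (@irr n) (c :: r) ->
  Esum c r t.+1 =
    \sum_(z <- words t.+1 | nf z == r) wweight z * om t.+1 (head c z) c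
  + \sum_(z <- words t.+1 | nf z == diag c.1 :: r)
       wweight z * om t.+1 (head c z) c.
Proof.
move=> sc; rewrite /Esum last_sumS.
rewrite (eq_bigl (fun z => (nf z == r) || (nf z == diag c.1 :: r))); last first.
  by move=> z; rewrite push_eq_head // nf_irr.
rewrite (bigID (fun z => nf z == r)) /=; congr (_ + _); apply: eq_bigl => z.
  by case: (nf z == r); rewrite ?andbF.
(* The stacks r and [diag c.1 :: r] differ in size, so the two cases are disjoint. *)
case: eqP => [->|] /=; last by rewrite andbT.
by apply/esym/negP => /eqP /(congr1 size) /eqP; rewrite /= ltn_eqF.
Qed.

Lemma EsumS_nil c t :
  Esum c [::] t.+1 = Esum (diag c.1) [::] t * om t.+1 (diag c.1) c.
Proof.
rewrite Esum_split // big_seq_cond big1 ?add0r => [|z /andP[zw /eqP nz]].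
  rewrite (sum_words_headE c _ _ _ (fun d => om t.+1 d c)).
  by rewrite /Lsum free_diag mul0r addr0.
by move: (nf_words_nonnil zw); rewrite nz.
Qed.

Lemma EsumS_cons c d r t : sorted (@irr n) (c :: d :: r) -> d.2 != c.1 ->
  Esum c (d :: r) t.+1 =
    Esum d r t * om t.+1 d c + Lsum d r t * om t.+1 (diag d.2) c
  + Esum (diag c.1) (d :: r) t * om t.+1 (diag c.1) c.
Proof.
move=> sc ne; rewrite Esum_split //.
rewrite !(sum_words_headE c _ _ _ (fun d => om t.+1 d c)).
by rewrite [Lsum (diag _) _ _]/Lsum free_diag mul0r addr0.
Qed.

(** Here [diag c.1 :: d :: r] is reducible, so only the first sum of [Esum_split] survives. *)
Lemma EsumS_primary c d r t : sorted (@irr n) (c :: d :: r) -> d.2 = c.1 ->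
  Esum c (d :: r) t.+1 =
    Esum d r t * om t.+1 d c + Lsum d r t * om t.+1 (diag d.2) c.
Proof.
move=> sc e; rewrite Esum_split //.
rewrite (sum_words_headE c _ _ _ (fun d => om t.+1 d c)).
rewrite -[RHS]addr0; congr (_ + _).
rewrite big_pred0 // => z; apply/negP => /eqP nz.
by move: (nf_irr z); rewrite nz /= /irr e eqxx free_diag.
Qed.
End Transfer.

(** * Difference conditions around free letters *)

Section Gaps.
Variable n : nat.
Implicit Types (c d : colour n).

(** [Delta] over the natural numbers: the truncated subtractions are exact, since each subtracted
    condition implies the one it is subtracted from. *)
Definition gapP d c : nat :=
  ((c.1 <= d.1)%N - ((d.1 == d.2) && (d.2 == c.1))
   + ((d.2 <= c.2)%N - ((d.2 == c.1) && (c.1 == c.2))))%N.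

(** Sum of the least differences imposed by the two row orders on consecutive columns of colours d
    and c. *)
Definition gapF d c : nat := ((c.1 <= d.1)%N + (d.2 <= c.2)%N)%N.

(** For non-free c, [ndesc c] and [nasc c] are the values of [gapP] between c and the free letters
    it absorbs on its right and left ([gapP_self], [gapP_diagl]). *)
Definition ndesc c : bool := (c.2 <= c.1)%N.
Definition nasc c : bool := (c.1 <= c.2)%N.

Lemma DeltaE d c : Delta d c = (gapP d c)%:Z.
Proof.
case: d c => [i k] [i' k']; rewrite /Delta /gapP /chi /= -!(inj_eq val_inj) /=.
lia.
Qed.

Lemma desc_asc c : ~~ free c -> nasc c = ~~ ndesc c.
Proof. by case: c => i k; rewrite /free /nasc /ndesc -(inj_eq val_inj) /=; lia. Qed.

Lemma gapP_self c : ~~ free c -> gapP c (diag c.2) = ndesc c.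
Proof.
case: c => i k; rewrite /free /gapP /ndesc -!(inj_eq val_inj) /=; lia.
Qed.

Lemma gapF_self c : gapF c (diag c.2) = (ndesc c).+1.
Proof. by rewrite /gapF /= leqnn addn1. Qed.

Lemma gapP_diag k : gapP (diag k) (diag k : colour n) = 0%N.
Proof. by rewrite /gapP /= eqxx leqnn. Qed.

Lemma gapF_diag k : gapF (diag k) (diag k : colour n) = 2%N.
Proof. by rewrite /gapF /= leqnn. Qed.

Lemma gapP_diagl c : ~~ free c -> gapP (diag c.1) c = nasc c.
Proof.
case: c => i k; rewrite /free /gapP /nasc -!(inj_eq val_inj) /=; lia.
Qed.

Lemma gapF_diagl c : gapF (diag c.1) c = (nasc c).+1.
Proof. by rewrite /gapF /= leqnn. Qed.

Lemma gapP_primary d c : ~~ free d -> ~~ free c -> d.2 = c.1 ->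
  gapP d c = (ndesc d + nasc c)%N.
Proof.
case: d c => [i j] [k l]; rewrite /free /gapP /nasc /ndesc /=.
by move=> /negPf nd /negPf nc e; rewrite nd e nc andbF !subn0.
Qed.

Lemma gapF_primary d c : d.2 = c.1 -> gapF d c = (ndesc d + nasc c)%N.
Proof. by rewrite /gapF /nasc /ndesc => ->. Qed.

Lemma gapPF d c : d.2 != c.1 -> gapP d c = gapF d c.
Proof. by rewrite /gapF /gapP => /negPf->; rewrite andbF !subn0. Qed.

Lemma gapF_diag_neq (j k : 'I_n) : j != k -> gapF (diag j) (diag k) = 1%N.
Proof. by rewrite /gapF -(inj_eq val_inj) /=; lia. Qed.

(* The gap rule d, c splits along the free letters (j, j), (k, k) that may be
   inserted between d = (i, j) and c = (k, l). *)
Lemma gapF_split d c : d.2 != c.1 ->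
  (gapF d c).+1 = (gapF d (diag c.1) + gapF (diag d.2) c)%N.
Proof.
by case: d c => [i j] [k l]; rewrite /gapF -(inj_eq val_inj) /=; lia.
Qed.

Lemma gapF_diagr_free d (k : 'I_n) :
  free d -> d.2 != k -> gapF d (diag k) = 1%N.
Proof. by move=> fd ne; rewrite (free_diagr fd) gapF_diag_neq. Qed.

Lemma gapF_diagr_cases d (k : 'I_n) : ~~ free d -> d.2 != k ->
  gapF d (diag k) = ndesc d \/ gapF d (diag k) = (ndesc d).+1.
Proof.
by case: d => i j; rewrite /gapF /free /ndesc -!(inj_eq val_inj) /=; lia.
Qed.

Lemma gapF_diagl_cases c (j : 'I_n) : ~~ free c -> j != c.1 ->
  gapF (diag j) c = nasc c \/ gapF (diag j) c = (nasc c).+1.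
Proof.
by case: c => k l; rewrite /gapF /free /nasc -!(inj_eq val_inj) /=; lia.
Qed.
End Gaps.

(** * Common coefficients *)

Section Invariant.
Variables (n : nat) (K : fieldType) (q : K).
Hypothesis q_neq0 : q != 0.
Hypothesis q_aper : forall p, 1 - q ^+ p.+1 != 0.
Implicit Types (c d : colour n) (r : seq (colour n)) (l : seq (K * nat)).

Local Notation TP := (TP q).
Local Notation TF := (TF q).
Local Notation mu := (mu q).

(** A partition has one difference at each place and a Frobenius array two independent ones, whence
    the exponents of $1-q^p$. *)
Definition omP p d c : K := (q ^+ p) ^+ gapP d c / (1 - q ^+ p).
Definition omF p d c : K := (q ^+ p) ^+ gapF d c / (1 - q ^+ p) ^+ 2.

Lemma omPE p d c : omP p d c = (q ^+ p) ^+ gapP d c / (1 - q ^+ p).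
Proof. by []. Qed.

Lemma omFE p d c : omF p d c = (q ^+ p) ^+ gapF d c / (1 - q ^+ p) ^+ 2.
Proof. by []. Qed.

Local Notation EP := (Esum omP).
Local Notation LP := (Lsum omP).
Local Notation EF := (Esum omF).
Local Notation LF := (Lsum omF).

Definition lin l (f : nat -> K) : K := \sum_(x <- l) x.1 * f x.2.

Lemma lin_cat l1 l2 f : lin (l1 ++ l2) f = lin l1 f + lin l2 f.
Proof. by rewrite /lin big_cat. Qed.

Lemma lin_map l (g : K * nat -> K * nat) f :
  lin [seq g x | x <- l] f = \sum_(x <- l) (g x).1 * f (g x).2.
Proof. by rewrite /lin big_map. Qed.

Lemma divDl (a b u v w : K) : a * (u / w) + b * (v / w) = (a * u + b * v) / w.
Proof. by rewrite !mulrA mulrDl. Qed.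

(* The point of the invariants is that one list l of coefficients serves both
   families; it is never computed. *)
Definition Inv_free c r := exists l, forall t,
  EP c r t = (1 - q ^+ t.+1) * lin l (TP t.+1) /\
  EF c r t * q ^+ t.+1 =
    (1 - q ^+ t.+1) ^+ 2 * lin l (fun s => q ^+ s * TF t.+1 s).

Definition Inv_nonfree c r := exists l, forall t,
  EP c r t = (q ^+ t) ^+ nasc c * lin l (TP t) /\
  EF c r t = (q ^+ t) ^+ nasc c * lin l (TF t).

Definition Inv c r := if free c then Inv_free c r else Inv_nonfree c r.

(* Words with kernel d :: r followed by a gap, whose size is e after a last
   letter d and 1 after an inserted last letter (d.2, d.2). *)
Definition gap_form d r e l := forall t,
  (EP d r t * (q ^+ t.+1) ^+ e + LP d r t * q ^+ t.+1) / (1 - q ^+ t.+1) =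
    q ^+ t.+1 * lin l (TP t.+1) /\
  (EF d r t * (q ^+ t.+1) ^+ e + LF d r t * q ^+ t.+1) / (1 - q ^+ t.+1) ^+ 2 =
    lin l (fun s => q ^+ s * TF t.+1 s).

(** Matches [LsumS] with [TP_mu] and [TF_mu]. As exactly one of [nasc c], [ndesc c] holds, the
    powers multiplying the [Esum] term combine to $q^t$ times q to the power [ndesc c], with a
    further $q^{t+1}$ for F_n: the source term of those recurrences. *)
Lemma Lsum_lin c r l : sorted (@irr n) (c :: r) -> ~~ free c ->
  (forall t, EP c r t = (q ^+ t) ^+ nasc c * lin l (TP t) /\
             EF c r t = (q ^+ t) ^+ nasc c * lin l (TF t)) ->
  let l' := [seq (x.1 * q ^+ ndesc c * mu x.2, x.2.+1) | x <- l] in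
  forall t, LP c r t = lin l' (TP t) /\ LF c r t = q ^+ t * lin l' (TF t).
Proof.
move=> sc nc H l'; elim=> [|t [IHP IHF]].
  rewrite !Lsum0 /l' !lin_map; split.
    by rewrite big1 // => x _; rewrite TP0 mulr0.
  by rewrite big1 ?mulr0 // => x _; rewrite TF0 mulr0.
have nz := q_aper t; have nzq := qX_neq0 q_neq0 t.
rewrite !LsumS // /omP /omF gapP_self // gapF_self gapP_diag gapF_diag.
case: (H t) => -> ->; rewrite {}IHP {}IHF /l' !lin_map {H} /lin desc_asc //.
rewrite !(mulr_sumr, mulr_suml) -!big_split /=.
split; apply: eq_bigr => -[a s] _ /=.
  apply: (mulfI nz); transitivity (a * q ^+ ndesc c *
    ((1 - q ^+ t.+1) * (mu s * TP t.+1 s.+1))); last by ring.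
  rewrite TP_mu //; move: nz; case: ndesc; rewrite !exprS !expr0 => ?; by field.
apply: (mulfI nz); apply: (mulfI nz); transitivity (a * q ^+ ndesc c * q ^+ t.+1 *
    ((1 - q ^+ t.+1) ^+ 2 * (mu s * TF t.+1 s.+1))); last by ring.
rewrite TF_mu //; move: nz; case: ndesc; rewrite !exprS !expr0 => ?; by field.
Qed.

Lemma gap_nonfree d r (e : nat) : sorted (@irr n) (d :: r) -> ~~ free d ->
  Inv_nonfree d r -> e = ndesc d \/ e = (ndesc d).+1 ->
  exists l, gap_form d r e l.
Proof.
move=> sd nd [l H] he; pose b := e == ndesc d.
(* The two values of e differ by a factor $q^{t+1}$ on [Esum]; in both families this changes the
   coefficient of index s+1 by exactly $q^{s+1}$. The [pred] lemmas show it by reducing every term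
   to length t+1 and index s+1. *)
exists [seq (x.1 * q ^+ ndesc d * mu x.2 / (q ^+ x.2.+1) ^+ b, x.2.+1) | x <- l].
move=> t; case: (Lsum_lin sd nd H t) => -> ->; case: (H t) => -> ->.
have nz := q_aper t; have nzq := qX_neq0 q_neq0 t.
rewrite !lin_map {H} /lin desc_asc // !(mulr_sumr, mulr_suml) -!big_split /=.
have -> : (q ^+ t.+1) ^+ e = (q ^+ t.+1) ^+ ndesc d * (q ^+ t.+1) ^+ (~~ b).
  rewrite -exprD; congr (_ ^+ _); rewrite /b.
  by case: he => ->; rewrite ?eqxx ?gtn_eqF //= ?addn0 ?addn1.
have qs := qX_neq0 q_neq0.
rewrite !(mulr_sumr, mulr_suml); split; apply: eq_bigr => -[a s] _ /=.
  rewrite [TP t s.+1]TP_pred // [TP t s]TP_pred2 //; have := qs s.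
  move: nz; case: ndesc; case: b; rewrite !(exprS, expr0) => ??; field; nonzero.
rewrite [TF t s.+1]TF_pred // [TF t s]TF_pred2 //; have := qs s.
move: nz; case: ndesc; case: b; rewrite !(exprS, expr0) => ??; field; nonzero.
Qed.

Definition free_step l : seq (K * nat) :=
  [seq (x.1 * mu x.2, x.2.+1) | x <- l] ++
  [seq (if x.2 == 0%N then - x.1 else 0, 0%N) | x <- l].

Lemma lin_free_step l f :
  lin (free_step l) f = \sum_(x <- l)
    (x.1 * (mu x.2 * f x.2.+1) - x.1 * (x.2 == 0%N)%:R * f 0%N).
Proof.
rewrite /free_step lin_cat !lin_map -big_split; apply: eq_bigr => x _ /=.
by case: eqP => _; rewrite ?mulr1 ?mulr0 ?mul0r ?mulNr ?oppr0 mulrA.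
Qed.

(* The term of index 0 in free_step compensates the vanishing of Esum at
   length 1, where the recurrence does not apply. *)
Lemma gap_free d r k l : sorted (@irr n) (d :: r) -> d.2 != k ->
  gap_form d r (gapF d (diag k)) l -> forall t,
  EP (diag k) (d :: r) t = (1 - q ^+ t.+1) * lin (free_step l) (TP t.+1) /\
  EF (diag k) (d :: r) t * q ^+ t.+1 = (1 - q ^+ t.+1) ^+ 2 *
    lin (free_step l) (fun s => q ^+ s * TF t.+1 s).
Proof.
move=> sd ne H; have sf : sorted (@irr n) (diag k :: d :: r).
  by rewrite /= in sd *; rewrite sd andbT /irr /= (negPf ne).
elim=> [|t [IHP IHF]].
  rewrite !Esum0 !mul0r !lin_free_step !mulr_sumr.
  split; rewrite big1 // => -[a s] _ /=.
    transitivity (a * ((1 - q ^+ 1) * (mu s * TP 1 s.+1))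
       - a * (s == 0%N)%:R * ((1 - q ^+ 1) * TP 1 0)); first by ring.
    by rewrite TP_mu // TP_rec0 // !TP0 /=; ring.
  transitivity (a * q ^+ s.+1 * ((1 - q ^+ 1) ^+ 2 * (mu s * TF 1 s.+1))
       - a * (s == 0%N)%:R * ((1 - q ^+ 1) ^+ 2 * TF 1 0)); first by ring.
  by rewrite TF_mu // TF_rec0 // !TF0 /=; case: s => [|s] /=; ring.
have nz := q_aper t; have nzq := qX_neq0 q_neq0 t.
have [HP HF] := H t; rewrite !EsumS_cons // !(omPE, omFE) gapP_diag gapF_diag.
rewrite !(gapPF, gapF_diag_neq) // expr1 [diag (diag k).1]/=.
rewrite !divDl HP HF IHP.
have -> : EF (diag k) (d :: r) t = (1 - q ^+ t.+1) ^+ 2 *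
    lin (free_step l) (fun s : nat => q ^+ s * TF t.+1 s) / q ^+ t.+1.
  by rewrite -IHF mulfK // qX_neq0.
rewrite !lin_free_step /lin !(mulr_sumr, mulr_suml) -!big_split /= mulr_suml.
split; apply: eq_bigr => -[a s] _ /=.
  transitivity (a * ((1 - q ^+ t.+2) * (mu s * TP t.+2 s.+1))
     - a * (s == 0%N)%:R * ((1 - q ^+ t.+2) * TP t.+2 0)); last by ring.
  by rewrite TP_mu // TP_rec0 //; field.
transitivity (a * q ^+ s.+1 * ((1 - q ^+ t.+2) ^+ 2 * (mu s * TF t.+2 s.+1))
     - a * (s == 0%N)%:R * ((1 - q ^+ t.+2) ^+ 2 * TF t.+2 0)); last by ring.
rewrite TF_mu // TF_rec0 //; move: nz; rewrite !(exprS, expr0) => nz.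
by field; nonzero.
Qed.

(** [EsumS_primary] and [LsumS] have proportional right-hand sides, so the coefficients are those
    that [Lsum_lin] gives for d. *)
Lemma Inv_primary c d r : sorted (@irr n) (c :: d :: r) -> ~~ free c ->
  ~~ free d -> d.2 = c.1 -> Inv_nonfree d r -> Inv_nonfree c (d :: r).
Proof.
move=> sc nc nd e [l H]; have sd := path_sorted sc.
exists [seq (x.1 * q ^+ ndesc d * mu x.2, x.2.+1) | x <- l] => t.
have HL := Lsum_lin sd nd H.
case: t => [|t].
  rewrite !Esum0 !lin_map; split; rewrite big1 ?mulr0 // => -[a s] _.
    by rewrite TP0 mulr0.
  by rewrite TF0 mulr0.
have [<- _] := HL t.+1; have nzq := qX_neq0 q_neq0 t.+1.
have -> : lin [seq (x.1 * q ^+ ndesc d * mu x.2, x.2.+1) | x <- l] (TF t.+1)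
     = LF d r t.+1 / q ^+ t.+1.
  by case: (HL t.+1) => _ ->; rewrite [RHS]mulrC mulKf.
rewrite !EsumS_primary // !LsumS // !(omPE, omFE) gapP_primary // gapF_primary //.
rewrite gapP_self // gapF_self gapP_diag gapF_diag e gapP_diagl // gapF_diagl.
have := q_aper t; rewrite !exprD [_ ^+ (ndesc d).+1]exprS [_ ^+ (nasc c).+1]exprS.
by move=> ?; split; field; nonzero.
Qed.

(** By [gapF_split], the words where c follows d or [diag d.2] reproduce the [gap_form] from d to
    [diag c.1] up to a power of q; those where c follows an inserted [diag c.1] are given by
    [gap_free]. *)
Lemma Inv_secondary c d r l : sorted (@irr n) (c :: d :: r) -> ~~ free c ->
  d.2 != c.1 -> gap_form d r (gapF d (diag c.1)) l -> Inv_nonfree c (d :: r).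
Proof.
move=> sc nc ne H; have sd := path_sorted sc.
have Hf := gap_free sd ne H.
pose b := gapF (diag d.2) c == nasc c.
have eb (x : K) : x ^+ gapF (diag d.2) c = x ^+ nasc c * x ^+ (~~ b).
  rewrite -exprD /b; have [->|->] := gapF_diagl_cases nc ne.
    by rewrite eqxx addn0.
  by rewrite gtn_eqF // addn1.
(* The first two blocks come from [TP_scale] or [TF_scale], according to b, together with the [mu]
   term of [free_step]. The last block is the index 0 part of [free_step]; it makes the sum vanish
   at length 0. *)
exists ([seq (x.1 * (q ^+ x.2) ^+ (~~ b), x.2) | x <- l] ++
        [seq (x.1 * (mu x.2 - (~~ b)%:R * q ^+ x.2), x.2.+1) | x <- l] ++
        [seq (if x.2 == 0%N then - x.1 else 0, 0%N) | x <- l]) => t.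
have lin_l f : lin ([seq (x.1 * (q ^+ x.2) ^+ (~~ b), x.2) | x <- l] ++
        [seq (x.1 * (mu x.2 - (~~ b)%:R * q ^+ x.2), x.2.+1) | x <- l] ++
        [seq (if x.2 == 0%N then - x.1 else 0, 0%N) | x <- l]) f =
  \sum_(x <- l) (x.1 * (q ^+ x.2) ^+ (~~ b) * f x.2
     + x.1 * (mu x.2 - (~~ b)%:R * q ^+ x.2) * f x.2.+1
     - x.1 * (x.2 == 0%N)%:R * f 0%N).
  rewrite !lin_cat !lin_map -!big_split; apply: eq_bigr => x _ /=.
  by case: eqP => _; rewrite ?mulr1 ?mulr0 ?mul0r ?mulNr ?oppr0 addrA.
rewrite !{}lin_l; case: t => [|t].
  rewrite !Esum0; split; rewrite big1 ?mulr0 // => -[a s] _ /=.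
    rewrite !TP0; case: s => [|s] /=; last by ring.
    by rewrite !expr0 expr1n; ring.
  rewrite !TF0; case: s => [|s] /=; last by ring.
  by rewrite !expr0 expr1n; ring.
have nz := q_aper t; have nzq := qX_neq0 q_neq0 t; have nzq1 := qX_neq0 q_neq0 t.+1.
have [HP HF] := H t; have [HfP HfF] := Hf t.
rewrite !EsumS_cons // !(omPE, omFE) gapP_diagl // gapF_diagl.
have ed (x : K) : x != 0 -> x ^+ gapF d c =
    x ^+ gapF d (diag c.1) * (x ^+ nasc c * x ^+ (~~ b)) / x.
  by move=> x0; rewrite -eb -exprD -gapF_split // exprSr mulfK.
rewrite !gapPF // ed // eb [_ ^+ (nasc c).+1]exprS.
set x := q ^+ t.+1 in nz nzq1 HP HF HfP HfF *.
split.
  transitivity (x ^+ nasc c * (x ^+ (~~ b) * lin l (TP t.+1)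
                + lin (free_step l) (TP t.+1))).
    have -> : lin l (TP t.+1) = (EP d r t * x ^+ gapF d (diag c.1) + LP d r t * x)
        / (1 - x) / x by rewrite HP [x * _]mulrC mulfK.
    by rewrite HfP; field; nonzero.
  congr (_ * _); rewrite lin_free_step /lin mulr_sumr -big_split.
  apply: eq_bigr => -[a s] _ /=; case: (b); rewrite /= ?expr0 ?expr1; first by ring.
  by rewrite mulrCA TP_scale //; ring.
transitivity (x ^+ nasc c * (x ^+ (~~ b) / x * lin l (fun s => q ^+ s * TF t.+1 s)
              + lin (free_step l) (fun s => q ^+ s * TF t.+1 s))).
  have -> : EF (diag c.1) (d :: r) t = (1 - x) ^+ 2 *
      lin (free_step l) (fun s => q ^+ s * TF t.+1 s) / x.
    by rewrite -HfF mulfK.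
  by rewrite -HF; field; nonzero.
congr (_ * _); rewrite lin_free_step /lin mulr_sumr -big_split.
apply: eq_bigr => -[a s] _ /=; rewrite expr0 mul1r.
rewrite [mu s * _]mulrA mu_shift //; have nzs := qX_neq0 q_neq0 s.
case: (b); rewrite /= ?expr0 ?expr1.
  rewrite [TF t.+1 s in X in X + _]TF_scale //.
  by rewrite -/x; field; nonzero.
by rewrite divff //; ring.
Qed.

Lemma Esum_diag_nil k t :
  EP (diag k) [::] t = TP t 0 /\ EF (diag k) [::] t = q ^+ t * TF t 0.
Proof.
elim: t => [|t [IHP IHF]]; first by rewrite !Esum0 TP0 TF0 mulr1.
rewrite !EsumS_nil !(omPE, omFE) gapP_diag gapF_diag IHP IHF; have nz := q_aper t.
split; apply: (mulfI nz).
  by rewrite TP_rec0 // expr0; field.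
apply: (mulfI nz); transitivity (q ^+ t.+1 * ((1 - q ^+ t.+1) ^+ 2 * TF t.+1 0));
  last by ring.
by rewrite TF_rec0 //; field.
Qed.

Lemma Inv_nil c : Inv c [::].
Proof.
rewrite /Inv; case: ifPn => fc; exists [:: (1, 0%N)] => t;
  rewrite /lin !big_seq1 !mul1r /=.
  rewrite (free_diagl fc); have [-> ->] := Esum_diag_nil c.1 t.
  by rewrite TP_rec0 // ?expr0 ?mul1r TF_rec0 //; split; ring.
case: t => [|t]; first by rewrite !Esum0 TP0 TF0 !expr0 !expr1n mulr1.
have [EPt EFt] := Esum_diag_nil c.1 t.
rewrite !EsumS_nil !(omPE, omFE) EPt EFt gapP_diagl // gapF_diagl.
have nz := q_aper t; rewrite -TP_rec0 //; split; first by field.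
rewrite exprS mulrA [_ * (_ * _)]mulrA -[q ^+ t * _ * _]mulrAC -TF_rec0 //.
by field.
Qed.

(** For free d, [Lsum] is 0 and [Inv_free] is a rearranged [gap_form] with e = 1. *)
Lemma gap_of_Inv d r (e : nat) : sorted (@irr n) (d :: r) -> Inv d r ->
  (if free d then e = 1%N else e = ndesc d \/ e = (ndesc d).+1) ->
  exists l, gap_form d r e l.
Proof.
rewrite /Inv => sd; case: ifPn => fd; last exact: gap_nonfree.
move=> [l H] ->; exists l => t; have [HP HF] := H t.
rewrite /Lsum fd mul0r addr0 expr1 HF HP; have nz := q_aper t.
by split; field.
Qed.

Lemma Inv_irr c r : sorted (@irr n) (c :: r) -> Inv c r.
Proof.
elim: r c => [|d r IH] c sc; first exact: Inv_nil.
have sd := path_sorted sc; have {IH} Id := IH _ sd.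
have [e|ne] := eqVneq d.2 c.1.
  have /norP[nc nd] : ~~ (free c || free d).
    by move: sc => /= /andP[]; rewrite /irr e eqxx.
  move: Id; rewrite /Inv (negPf nc) (negPf nd); exact: Inv_primary.
have [l Hl] : exists l, gap_form d r (gapF d (diag c.1)) l.
  apply: gap_of_Inv => //; case: ifPn => fd; first exact: gapF_diagr_free.
  exact: gapF_diagr_cases.
rewrite /Inv; case: ifPn => fc; last exact: Inv_secondary Hl.
by exists (free_step l); rewrite (free_diagl fc); exact: gap_free.
Qed.

Lemma total_lin d r : sorted (@irr n) (d :: r) -> exists l, forall t,
  \sum_(z <- words n t.+1 | nf z == d :: r)
     wweight omP z * (q ^+ t.+1 / (1 - q ^+ t.+1)) = q ^+ t.+1 * lin l (TP t.+1) /\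
  \sum_(z <- words n t.+1 | nf z == d :: r)
     wweight omF z * (q ^+ t.+1 / (1 - q ^+ t.+1) ^+ 2) =
     lin l (fun s => q ^+ s * TF t.+1 s).
Proof.
(* Smallest parts are at least 1 and each column counts 1, so the closing factor is that of a gap of
   size 1, which is [ndesc d] or its successor whatever d is. *)
move=> sd; have [|l H] := gap_of_Inv (e := 1) sd (Inv_irr sd).
  by case: ifP => // _; case: ndesc; [left|right].
exists l => t; have [<- <-] := H t; rewrite expr1.
by rewrite !(sum_words_head _ _ _ _ (fun=> _)) !mulrA -!mulrDl.
Qed.
End Invariant.

(** * Congruences modulo powers of q *)

Section BigO.
Notation K := {fraction {poly rat}}.
Local Notation "p %:F" := (@FracField.tofrac _ p).
Implicit Types (x y : K) (u v : {poly rat}).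

(* x lies in q^N times the local ring of fractions without pole at q = 0. *)
Definition bigO N x := exists u v, v`_0 != 0 /\ x * v%:F = ('X^N * u)%:F.

Lemma tofrac_coef0_neq0 v : v`_0 != 0 -> v%:F != 0.
Proof.
by move=> v0; rewrite tofrac_eq0; apply: contraNneq v0 => ->; rewrite coef0.
Qed.

Lemma bigO_X N : bigO N ('X^N)%:F.
Proof. by exists 1, 1; rewrite coef1 oner_neq0 mulr1 rmorph1 mulr1. Qed.

Lemma bigO_poly u : bigO 0 u%:F.
Proof. by exists u, 1; rewrite coef1 oner_neq0 rmorph1 mulr1 mul1r. Qed.

Lemma bigO_inv v : v`_0 != 0 -> bigO 0 (v%:F)^-1.
Proof.
move=> v0; exists 1, v; split=> //.
by rewrite mulVf ?tofrac_coef0_neq0 // mulr1 expr0 rmorph1.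
Qed.

Lemma bigOM N M x y : bigO N x -> bigO M y -> bigO (N + M) (x * y).
Proof.
move=> [u [v [v0 e]]] [u' [v' [v0' e']]]; exists (u * u'), (v * v').
rewrite coef0M mulf_neq0 //; split => //.
by rewrite rmorphM mulrACA e e' -rmorphM exprD; congr (_%:F); ring.
Qed.

Lemma bigOMl N x y : bigO 0 x -> bigO N y -> bigO N (x * y).
Proof. exact: bigOM. Qed.

Lemma bigOMr N x y : bigO N x -> bigO 0 y -> bigO N (x * y).
Proof. by move=> ox oy; rewrite -[N]addn0; exact: bigOM. Qed.

Lemma bigOD N x y : bigO N x -> bigO N y -> bigO N (x + y).
Proof.
move=> [u [v [v0 e]]] [u' [v' [v0' e']]]; exists (u * v' + u' * v), (v * v').
rewrite coef0M mulf_neq0 //; split => //.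
transitivity (('X^N * u)%:F * v'%:F + ('X^N * u')%:F * v%:F).
  by rewrite -e -e' rmorphM; ring.
by rewrite -!rmorphM -rmorphD; congr (_%:F); ring.
Qed.

Lemma bigON N x : bigO N x -> bigO N (- x).
Proof.
move=> [u [v [v0 e]]]; exists (- u), v; split=> //.
by rewrite mulNr e mulrN rmorphN.
Qed.

Lemma bigOB N x y : bigO N x -> bigO N y -> bigO N (x - y).
Proof. by move=> ox oy; apply: bigOD => //; exact: bigON. Qed.

Lemma bigO0 N : bigO N 0.
Proof. by exists 0, 1; rewrite coef1 oner_neq0 mulr0 rmorph0 mul0r. Qed.

Lemma bigO_sum N (I : Type) (r : seq I) (P : pred I) (F : I -> K) :
  (forall i, P i -> bigO N (F i)) -> bigO N (\sum_(i <- r | P i) F i).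
Proof.
by move=> H; elim/big_ind: _ => //; [exact: bigO0 | move=> x y; exact: bigOD].
Qed.

Lemma bigO_le M N x : (M <= N)%N -> bigO N x -> bigO M x.
Proof.
move=> /subnKC<- [u [v [v0 e]]]; exists ('X^(N - M) * u), v; split=> //.
by rewrite e exprD mulrA.
Qed.

Lemma fraction_repr x : exists u v, v != 0 /\ x * v%:F = u%:F.
Proof.
elim/quotW: x => r; exists (\n_r), (\d_r); split; first exact: denom_ratioP.
unlock FracField.tofrac; rewrite -[LHS]FracField.pi_mul; apply/eqmodP.
rewrite /= FracField.equivfE /FracField.mulf.
by rewrite !numden_Ratio ?mulr1 ?oner_neq0 ?denom_ratioP // mulrC.
Qed.

Lemma poly_split_X v :
  v != 0 -> exists L (w : {poly rat}), w`_0 != 0 /\ v = 'X^L * w.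
Proof.
move=> v0; have [L [w]] := multiplicity_XsubC v 0.
rewrite v0 /= subr0 rootE horner_coef0 => w0 ->; exists L, w.
by rewrite mulrC.
Qed.

Definition qF : K := 'X%:F.

Lemma qFX p : qF ^+ p = ('X^p)%:F.
Proof. by rewrite rmorphXn. Qed.

(** Bounds the pole at q = 0; no more has to be known about the uncomputed coefficients. *)
Lemma bigO_exists x : exists L, bigO 0 (qF ^+ L * x).
Proof.
have [u [v [v0 e]]] := fraction_repr x; have [L [w [w0 ve]]] := poly_split_X v0.
exists L, u, w; split => //.
by rewrite qFX mulrAC -rmorphM -ve mulrC e mul1r.
Qed.

Lemma bigO_coef N (p : {poly rat}) m : bigO N p%:F -> (m < N)%N -> p`_m = 0.
Proof.
move=> [u [v [v0 /eqP]]]; rewrite -rmorphM tofrac_eq => /eqP e ltmN.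
have : 'X^N %| p * v by rewrite e dvdp_mulr.
rewrite Gauss_dvdpl; last first.
  by rewrite coprimep_expl // coprimep_sym coprimepX rootE horner_coef0.
by move=> /dvdpP[w ->]; rewrite coefMXn ltmN.
Qed.

Lemma qF_neq0 : qF != 0.
Proof. by rewrite tofrac_eq0 polyX_eq0. Qed.

Lemma one_sub_qF p : 1 - qF ^+ p = (1 - 'X^p : {poly rat})%:F.
Proof. by rewrite rmorphB rmorph1 qFX. Qed.

Lemma coef0_one_subX p : (1 - 'X^(p.+1) : {poly rat})%R`_0 != 0.
Proof. by rewrite coefB coef1 coefXn subr0 oner_neq0. Qed.

Lemma qF_aper p : 1 - qF ^+ p.+1 != 0.
Proof. by rewrite one_sub_qF tofrac_coef0_neq0 // coef0_one_subX. Qed.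

Lemma bigO_qF p : bigO p (qF ^+ p).
Proof. by rewrite qFX; exact: bigO_X. Qed.

Lemma bigO0_qF p : bigO 0 (qF ^+ p).
Proof. exact: bigO_le (bigO_qF p). Qed.

Lemma bigO_inv_one_sub p : bigO 0 (1 - qF ^+ p.+1)^-1.
Proof. by rewrite one_sub_qF; apply: bigO_inv; exact: coef0_one_subX. Qed.

Lemma bigO1 : bigO 0 1%R.
Proof. exact: (bigO_qF 0). Qed.

Lemma bigO_inv_qfact m : bigO 0 (qfact qF m)^-1.
Proof.
elim: m => [|m IH]; first by rewrite qfact0 invr1; exact: bigO1.
by rewrite qfactS invfM; apply: bigOMl => //; exact: bigO_inv_one_sub.
Qed.

Local Notation TP := (TP qF).
Local Notation TF := (TF qF).
Local Notation qfact := (qfact qF).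
Local Notation durfee := (durfee qF).

Lemma inv_qfact_stable m k : bigO m.+1 ((qfact m)^-1 - (qfact (m + k))^-1).
Proof.
elim: k => [|k IH]; first by rewrite addn0 subrr; exact: bigO0.
rewrite -(subrKA (qfact (m + k))^-1); apply: bigOD => //.
apply: (@bigO_le _ (m + k).+1); first by rewrite ltnS leq_addr.
have -> : (qfact (m + k))^-1 - (qfact (m + k.+1))^-1 =
    - (qF ^+ (m + k).+1 * (qfact (m + k.+1))^-1).
  by rewrite addnS; exact: inv_qfact_diff qF_aper _.
by apply: bigON; apply: bigOMr; [exact: bigO_qF | exact: bigO_inv_qfact].
Qed.

Lemma bigO_durfee s M : bigO (M * (M + s)) (durfee s M).
Proof.
by rewrite /durfee invfM; apply: bigOMr; [exact: bigO_qF |];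
  apply: bigOMl; exact: bigO_inv_qfact.
Qed.

Lemma sum_durfee_shift s m k :
  bigO (m + s) (\sum_(M < m) durfee s M - \sum_(M < m) durfee (s + k) M).
Proof.
elim: k => [|k IH]; first by rewrite addn0 subrr; exact: bigO0.
rewrite -(subrKA (\sum_(M < m) durfee (s + k) M)); apply: bigOD => //.
rewrite addnS -sumrB (durfee_telescope qF_aper); apply: bigON.
(* For m = 0 the factor $1-q^0$ vanishes; otherwise $m(m+s)\ge m+s$. *)
case: m {IH} => [|m]; first by rewrite subrr !mul0r; exact: bigO0.
rewrite invfM; apply: bigOMr; last by apply: bigOMl; exact: bigO_inv_qfact.
apply: bigOMl; first by rewrite one_sub_qF; exact: bigO_poly.
apply: bigO_le (bigO_qF _); rewrite mulSn; lia.
Qed.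

(** Both terms approach $1/(q)_\infty$. They are compared through [durfee (s + N) 0], which is
    $1/(q)_{s+N}$, and the Durfee sum of excess s + N, whose terms with M > 0 have order above N.
    The factor $q^s$ supplies the s orders lost in truncation. *)
Lemma sum_TF_TP N s :
  bigO N (qF ^+ s * (TP N s - \sum_(p < N.+1) TF p s)).
Proof.
have [le_sN|lt_Ns] := leqP s N; last first.
  rewrite TP_gt // big1 ?subr0 ?mulr0; first exact: bigO0.
  by move=> p _; apply: TF_gt; exact: leq_trans (ltn_ord p) lt_Ns.
rewrite sum_TF // /TP le_sN -{1}(subnKC le_sN); apply: bigOM; first exact: bigO_qF.
set m := (N - s)%N; rewrite -(subrKA (durfee (s + N) 0)); apply: bigOD.
  rewrite /durfee mul0n expr0 qfact0 mul1r mul1r add0n.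
  apply: (@bigO_le _ m.+1) => //.
  have -> : (s + N = m + (s + s))%N by rewrite /m; lia.
  exact: inv_qfact_stable.
rewrite -(subrKA (\sum_(M < m.+1) durfee (s + N) M)); apply: bigOD.
  rewrite big_ord_recl opprD addrA subrr add0r; apply: bigON; apply: bigO_sum => i _.
  apply: bigO_le (bigO_durfee _ _); rewrite lift0 mulSn; lia.
rewrite -opprB; apply: bigON; apply: bigO_le (sum_durfee_shift _ _ _); lia.
Qed.

Lemma total_diff n (d : colour n) r : sorted (@irr n) (d :: r) ->
  exists L, forall N, bigO N (qF ^+ L * \sum_(t < N)
    (\sum_(z <- words n t.+1 | nf z == d :: r)
       wweight (omP qF) z * (qF ^+ t.+1 / (1 - qF ^+ t.+1))
   - \sum_(z <- words n t.+1 | nf z == d :: r)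
       wweight (omF qF) z * (qF ^+ t.+1 / (1 - qF ^+ t.+1) ^+ 2))).
Proof.
move=> sd; have [l H] := total_lin qF_neq0 qF_aper sd.
(* One power of q clears the poles of the finitely many coefficients, uniformly in N. *)
have [L HL] : exists L, forall z, z \in l -> bigO 0 (qF ^+ L * z.1).
  elim: l {H} => [|z l [L HL]]; first by exists 0%N.
  have [M HM] := bigO_exists z.1; exists (L + M)%N => z'.
  rewrite inE exprD => /orP[/eqP->|yl].
    by rewrite -mulrA; apply: bigOMl; first exact: bigO0_qF.
  by rewrite mulrAC; apply: bigOMr; [exact: HL | exact: bigO0_qF].
exists L => N; rewrite (eq_bigr (fun t : 'I_N => \sum_(x <- l) x.1 *
  (qF ^+ t.+1 * TP t.+1 x.2 - qF ^+ x.2 * TF t.+1 x.2))); last first.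
  move=> t _; have [-> ->] := H t; rewrite /lin mulr_sumr -sumrB.
  by apply: eq_bigr => x _; rewrite mulrBr mulrCA.
rewrite exchange_big mulr_sumr big_seq; apply: bigO_sum => z zl.
rewrite -mulr_sumr mulrA; apply: bigOMl; first exact: HL.
(* The term p = 0 may be added to both sums, as [TP 0 s] equals $q^s$ times [TF 0 s]. *)
suff -> : \sum_(t < N) (qF ^+ t.+1 * TP t.+1 z.2 - qF ^+ z.2 * TF t.+1 z.2) =
    qF ^+ z.2 * (TP N z.2 - \sum_(p < N.+1) TF p z.2) by exact: sum_TF_TP.
rewrite mulrBr -(sum_TP qF_neq0 qF_aper) !big_ord_recl sumrB -mulr_sumr /=.
rewrite mul1r TP0 TF0.
rewrite mulrDr opprD; case: (z.2) => [|s] /=; last by rewrite mulr0 oppr0 !add0r.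
by rewrite expr0 mulr1 addrACA subrr add0r.
Qed.
End BigO.

(** * From words to partitions *)

Section Boxes.
(* An entry a of a reversed array has colour col a and weight w a; ok e a says
   that its values are at least e, and nxt a c is the bound that a imposes on a
   following entry of colour c.  Partitions and Frobenius partitions are both
   instances. *)
Local Notation K := {fraction {poly rat}}.
Variables (n N : nat) (T B : Type) (A : seq T) (col : T -> colour n)
  (w : T -> nat) (ok : B -> T -> bool) (nxt : T -> colour n -> B)
  (deg : B -> nat) (om : nat -> colour n -> colour n -> K) (den : nat -> K).
Implicit Types (c d : colour n) (b : colour n -> B) (phi : pred (seq (colour n))).

Fixpoint valid b (s : seq T) :=
  if s is a :: s' then ok (b (col a)) a && valid (nxt a) s' else true.

Hypothesis om_bigO : forall t d c, bigO 0 (om t.+1 d c).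
Hypothesis nxt_om : forall t a c, (qF ^+ t.+1) ^+ deg (nxt a c) * den t.+1 =
  (qF ^+ t.+1) ^+ w a * om t.+1 c (col a).
Hypothesis geom : forall t e c, bigO N ((qF ^+ t.+1) ^+ deg e * den t.+1 -
  \sum_(a <- A | (col a == c) && ok e a) (qF ^+ t.+1) ^+ w a).

Lemma bigO_wweight c t z : z \in words n t -> bigO 0 (wweight om (c :: z)).
Proof.
elim: t c z => [|t IH] c z; rewrite mem_seqs; case: z => [|d z] //=.
  by move=> _; exact: (bigO_qF 0).
move=> /andP[/eqP[sz] /andP[_ wz]]; apply: bigOMr; last exact: om_bigO.
by apply: IH; rewrite mem_seqs sz eqxx.
Qed.

(** Enumerates the first entry a, the smallest one, in place of the geometric series. It contributes
    $q^{w(a)}$ for itself and $(q^t)^{w(a)}$ for the t later entries, which it shifts up. In X only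
    this entry is enumerated; [wweight] still stands for the others. *)
Lemma box_tail t b phi :
  (forall a, bigO N (
    (qF ^+ t) ^+ w a *
      \sum_(z <- words n t | phi (col a :: z)) wweight om (col a :: z)
    - \sum_(s <- seqs A t | valid (nxt a) s && phi (col a :: map col s))
        qF ^+ (\sum_(x <- s) w x))) ->
  bigO N (\sum_c \sum_(z <- words n t | phi (c :: z))
       (qF ^+ t.+1) ^+ deg (b c) * wweight om (c :: z) * den t.+1
    - \sum_(s <- seqs A t.+1 | valid b s && phi (map col s))
        qF ^+ (\sum_(x <- s) w x)).
Proof.
move=> H; pose W c := \sum_(z <- words n t | phi (c :: z)) wweight om (c :: z).
pose X := \sum_(a <- A | ok (b (col a)) a)
  qF ^+ w a * ((qF ^+ t) ^+ w a * W (col a)).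
rewrite -(subrKA X); apply: bigOD.
  have -> : X = \sum_c (\sum_(a <- A | (col a == c) && ok (b c) a)
                          (qF ^+ t.+1) ^+ w a) * W c.
    rewrite /X (partition_big col xpredT) //; apply: eq_bigr => c _.
    rewrite mulr_suml; apply: eq_big => [a|a /andP[_ /eqP->]].
      by case: eqP => [->|]; rewrite ?andbT ?andbF.
    by rewrite mulrA -exprMn -exprS.
  rewrite -sumrB; apply: bigO_sum => c _.
  have -> : \sum_(z <- words n t | phi (c :: z))
       (qF ^+ t.+1) ^+ deg (b c) * wweight om (c :: z) * den t.+1 =
     (qF ^+ t.+1) ^+ deg (b c) * den t.+1 * W c.
    by rewrite mulr_sumr; apply: eq_bigr => z _; rewrite mulrAC.
  rewrite -mulrBl; apply: bigOMr; first exact: geom.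
  rewrite /W big_seq_cond; apply: bigO_sum => z /andP[zw _]; exact: bigO_wweight zw.
rewrite sum_seqsS /X big_mkcond -sumrB; apply: bigO_sum => a _ /=.
case: ok => /=; last by rewrite big_pred0 // subrr; exact: bigO0.
have -> : \sum_(s <- seqs A t | valid (nxt a) s && phi (col a :: map col s))
     qF ^+ (\sum_(x <- a :: s) w x) = qF ^+ w a *
   \sum_(s <- seqs A t | valid (nxt a) s && phi (col a :: map col s))
     qF ^+ (\sum_(x <- s) w x).
  by rewrite mulr_sumr; apply: eq_bigr => s _; rewrite big_cons exprD.
by rewrite -mulrBr; apply: bigOMl => //; exact: bigO0_qF.
Qed.

(** By [nxt_om], the bound set by a on the remaining entries amounts to shifting all of them by its
    weight and inserting a factor [om], as [box_tail] requires. *)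
Lemma box_sum t b phi :
  bigO N (\sum_c \sum_(z <- words n t | phi (c :: z))
       (qF ^+ t.+1) ^+ deg (b c) * wweight om (c :: z) * den t.+1
    - \sum_(s <- seqs A t.+1 | valid b s && phi (map col s))
        qF ^+ (\sum_(x <- s) w x)).
Proof.
elim: t b phi => [|t IH] b phi; apply: box_tail => a.
  rewrite /words /= !big_cons !big_nil !expr0 expr1n mul1r addr0.
  by case: (phi _); rewrite ?addr0 subrr; exact: bigO0.
have := IH (nxt a) (fun s => phi (col a :: s)).
congr (bigO N (_ - _)).
rewrite sum_seqsS mulr_sumr; apply: eq_bigr => c _.
rewrite mulr_sumr big_seq_cond [RHS]big_seq_cond.
apply: eq_bigr => z; rewrite mem_seqs => /andP[/andP[/eqP sz _] _].
by rewrite mulrAC nxt_om /= sz; ring.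
Qed.
End Boxes.

(** * Coefficients as counts over finite boxes *)

Lemma gf_seq (T : choiceType) (X : set T) (wt : T -> nat) m (s : seq T) :
  uniq s -> (forall x, (X x /\ wt x = m) <-> x \in s) ->
  finite_set [set x | X x /\ wt x = m]%classic /\ gf X wt m = size s.
Proof.
move=> us H.
have E : [set x | X x /\ wt x = m]%classic = [set` [fset x in s]%fset]%classic.
  by apply/seteqP; split => x /=; rewrite !inE /= => /H.
rewrite /gf E; split; first exact: finite_fset.
by rewrite set_fsetK card_fseq undup_id.
Qed.

(** Weight m bounds the length and the entries, so the arrays of weight m lie in a finite box; this
    yields both summability and an enumeration by length. *)
Lemma gf_box (T : choiceType) (X : set (seq T)) (wt : seq T -> nat)
    (Q : pred (seq T)) (w : T -> nat) (A : seq T) N m :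
  uniq A -> (forall s, X s <-> Q (rev s)) ->
  (forall s, wt s = \sum_(x <- rev s) w x)%N ->
  (forall s, Q s -> (\sum_(x <- s) w x)%N = m -> (size s <= N)%N && all [in A] s) ->
  finite_set [set x | X x /\ wt x = m]%classic /\
  gf X wt m = (\sum_(p < N.+1)
     count (fun s => Q s && ((\sum_(x <- s) w x)%N == m)) (seqs A p))%N.
Proof.
move=> uA XQ wtE bnd.
pose R s := Q s && ((\sum_(x <- s) w x)%N == m).
pose box := [seq s | p <- iota 0 N.+1, s <- [seq s <- seqs A p | R s]].
have boxP s : (s \in box) = R s.
  apply/allpairsPdep/idP => [[p [u [_ + ->]]]|Rs].
    by rewrite mem_filter => /andP[].
  have /andP[Qs /eqP ws] := Rs; have /andP[sN sA] := bnd s Qs ws.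
  exists (size s), s.
  by rewrite mem_iota /= add0n ltnS sN mem_filter Rs mem_seqs eqxx.
have ubox : uniq box.
  apply: allpairs_uniq_dep => [|p _|]; first exact: iota_uniq.
    by apply: filter_uniq; exact: uniq_seqs.
  move=> _ _ /allpairsPdep[p [u [_ + ->]]] /allpairsPdep[p' [u' [_ + ->]]] /= e.
  rewrite -{}e !mem_filter !mem_seqs.
  by move=> /andP[_ /andP[/eqP<- _]] /andP[_ /andP[/eqP<- _]].
have [||fin ->] := @gf_seq _ X wt m [seq rev s | s <- box].
- by rewrite map_inj_uniq //; exact: (can_inj revK).
- move=> s; rewrite -{3}[s]revK mem_map ?boxP; last exact: (can_inj revK).
  rewrite wtE XQ /R; split=> [[-> ->]|/andP[-> /eqP->]]; by rewrite ?eqxx.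
split=> //; rewrite size_map size_allpairs_dep sumnE big_map.
rewrite -[N.+1]subn0 -/(index_iota 0 _).
by rewrite big_mkord; apply: eq_bigr => p _; rewrite size_filter.
Qed.

Lemma coef_sum_X (R : nzSemiRingType) (I : Type) (r : seq I) (P : pred I)
    (f : I -> nat) m :
  (\sum_(i <- r | P i) 'X^(f i) : {poly R})`_m =
  (count (fun i => P i && (f i == m)) r)%:R.
Proof.
rewrite coef_sum -sum1_count natr_sum big_mkcondr; apply: eq_bigr => i _.
by rewrite coefXn eq_sym; case: eqP.
Qed.

(** * Boxes and geometric series for P_n and F_n *)

Section Instances.
Variable n : nat.
Local Notation K := {fraction {poly rat}}.

Lemma geom_sum t e N :
  bigO N ((qF ^+ t.+1) ^+ e / (1 - qF ^+ t.+1) -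
          \sum_(0 <= u < N | (e <= u)%N) (qF ^+ t.+1) ^+ u).
Proof.
suff -> : \sum_(0 <= u < N | (e <= u)%N) (qF ^+ t.+1) ^+ u =
    ((qF ^+ t.+1) ^+ e - (qF ^+ t.+1) ^+ maxn e N) / (1 - qF ^+ t.+1).
  rewrite -mulrBl subKr; apply: bigOMr (bigO_inv_one_sub _).
  rewrite -exprM; apply: bigO_le (bigO_qF _); nia.
elim: N => [|N IH]; first by rewrite big_nil maxn0 subrr mul0r.
rewrite big_mkcond big_nat_recr //= -big_mkcond {}IH.
have := qF_aper t; move: (qF ^+ t.+1) => x x1.
case: leqP => [le_eN|lt_Ne].
  rewrite (maxn_idPr (leqW le_eN)).
  by apply: (mulIf x1); rewrite mulrDl !divfK // exprS; ring.
by rewrite addr0 (maxn_idPl lt_Ne).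
Qed.

Definition boxP N : seq (nat * colour n) :=
  [seq (u, c) | u <- index_iota 0 N, c <- index_enum (colour n)].
Definition okP (e : nat) (a : nat * colour n) := (e <= a.1)%N.
Definition nxtP (a : nat * colour n) (c : colour n) : nat := (a.1 + gapP c a.2)%N.
Definition denP p : K := (1 - qF ^+ p)^-1.

Definition fentry := ((nat * 'I_n) * (nat * 'I_n))%type.
Definition fcol (a : fentry) : colour n := (a.1.2, a.2.2).
Definition fwt (a : fentry) : nat := (a.1.1 + a.2.1).+1.
Definition boxF N : seq fentry :=
  [seq ((uv.1, c.1), (uv.2, c.2)) |
     uv <- [seq (u, v) | u <- index_iota 0 N, v <- index_iota 0 N],
     c <- index_enum (colour n)].
Definition okF (e : nat * nat) (a : fentry) := (e.1 <= a.1.1)%N && (e.2 <= a.2.1)%N.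
Definition nxtF (a : fentry) (c : colour n) : nat * nat :=
  ((a.1.1 + (a.1.2 <= c.1)%N)%N, (a.2.1 + (c.2 <= a.2.2)%N)%N).
(** The factor $q^p$ is the unit that each of p columns adds to the weight. *)
Definition denF p : K := qF ^+ p / (1 - qF ^+ p) ^+ 2.

Lemma geomP N t e c : bigO N ((qF ^+ t.+1) ^+ e * denP t.+1 -
  \sum_(a <- boxP N | (a.2 == c) && okP e a) (qF ^+ t.+1) ^+ a.1).
Proof.
suff -> : \sum_(a <- boxP N | (a.2 == c) && okP e a) (qF ^+ t.+1) ^+ a.1 =
  \sum_(0 <= u < N | (e <= u)%N) (qF ^+ t.+1) ^+ u by exact: geom_sum.
rewrite big_mkcond big_allpairs_dep [RHS]big_mkcond /=; apply: eq_bigr => u _.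
rewrite (bigD1 c) //= eqxx /okP /= big1 ?addr0 // => c' /negPf->.
by [].
Qed.

Lemma geomF N t (e : nat * nat) c : bigO N ((qF ^+ t.+1) ^+ (e.1 + e.2) * denF t.+1 -
  \sum_(a <- boxF N | (fcol a == c) && okF e a) (qF ^+ t.+1) ^+ fwt a).
Proof.
pose S (i : nat) : K := \sum_(0 <= u < N | (i <= u)%N) (qF ^+ t.+1) ^+ u.
have -> : \sum_(a <- boxF N | (fcol a == c) && okF e a) (qF ^+ t.+1) ^+ fwt a =
    qF ^+ t.+1 * (S e.1 * S e.2).
  rewrite big_mkcond big_allpairs_dep big_allpairs_dep /S.
  rewrite [X in _ * (X * _)]big_mkcond.
  rewrite mulr_suml mulr_sumr; apply: eq_bigr => u _.
  rewrite [X in _ * (_ * X)]big_mkcond !mulr_sumr; apply: eq_bigr => v _ /=.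
  rewrite (bigD1 c) //= big1 ?addr0 /fcol /=; last first.
    by case=> i k /=; case: (c) => i' k' /negPf->.
  rewrite -surjective_pairing eqxx /okF /fwt /=.
  move: (qF ^+ t.+1) => x.
  by do 2 case: (leqP _ _) => _; rewrite /= ?mulr0 ?mul0r ?mulr0 // exprS exprD.
have -> : (qF ^+ t.+1) ^+ (e.1 + e.2) * denF t.+1 - qF ^+ t.+1 * (S e.1 * S e.2) =
  qF ^+ t.+1 * ((qF ^+ t.+1) ^+ e.1 / (1 - qF ^+ t.+1) *
      ((qF ^+ t.+1) ^+ e.2 / (1 - qF ^+ t.+1) - S e.2) +
      ((qF ^+ t.+1) ^+ e.1 / (1 - qF ^+ t.+1) - S e.1) * S e.2).
  move: (S e.1) (S e.2) (qF_aper t); rewrite /denF; move: (qF ^+ t.+1) => x s1 s2 x1.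
  by rewrite exprD expr2 invfM; ring.
apply: bigOMl; first exact: bigO0_qF.
apply: bigOD.
  apply: bigOMl; last exact: geom_sum.
  by rewrite -exprM; apply: bigOMl; [exact: bigO0_qF | exact: bigO_inv_one_sub].
apply: bigOMr; first exact: geom_sum.
by rewrite /S; apply: bigO_sum => u _; rewrite -exprM; exact: bigO0_qF.
Qed.
End Instances.

(** * Comparison of coefficients *)

Section Final.
Variable n : nat.
Local Notation K := {fraction {poly rat}}.

Definition validP := valid (@snd nat (colour n)) (@okP n) (@nxtP n).
Definition validF := valid (@fcol n) (@okF n) (@nxtF n).

Lemma uniq_boxP N : uniq (boxP n N).
Proof.
by apply: allpairs_uniq; rewrite ?iota_uniq ?index_enum_uniq // => -[? ?] [? ?].
Qed.

Lemma mem_boxP N a : (a \in boxP n N) = (a.1 < N)%N.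
Proof.
case: a => u c; apply/allpairsP/idP => [[[u' c'] /= [+ _ [-> _]]]|ltuN].
  by rewrite mem_index_iota.
by exists (u, c); rewrite mem_index_iota mem_index_enum.
Qed.

Lemma uniq_boxF N : uniq (boxF n N).
Proof.
apply: allpairs_uniq; rewrite ?index_enum_uniq //.
  by apply: allpairs_uniq; rewrite ?iota_uniq // => -[? ?] [? ?].
by move=> [[? ?] [? ?]] [[? ?] [? ?]] _ _ /= [-> -> -> ->].
Qed.

Lemma mem_boxF N a : (a \in boxF n N) = (a.1.1 < N)%N && (a.2.1 < N)%N.
Proof.
case: a => -[u i] [v k].
apply/allpairsP/andP => [[[[u' v'] [i' k']] /= [+ _ [-> _ -> _]]]|/= [uN vN]].
  by case/allpairsP => -[? ?] /= [+ + [-> ->]]; rewrite !mem_index_iota.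
exists ((u, v), (i, k)); split; rewrite ?mem_index_enum //.
by apply/allpairsP; exists (u, v); rewrite !mem_index_iota.
Qed.

Lemma validP_path a s :
  validP (nxtP a) s = path (fun a a' => (nxtP a a'.2 <= a'.1)%N) a s.
Proof. by elim: s a => //= a' s IH a; rewrite -IH. Qed.

Lemma in_P_rev (lam : cpart n) : in_P lam = validP (fun=> 1%N) (rev lam).
Proof.
rewrite /in_P -all_rev -{2}[lam]revK rev_sorted.
have -> : sorted (fun p p' : nat * colour n =>
    Delta p'.2 p.2 <= p'.1%:Z - p.1%:Z) (rev lam) =
    sorted (fun a a' => (nxtP a a'.2 <= a'.1)%N) (rev lam).
  apply: eq_sorted => a a'; rewrite DeltaE /nxtP; lia.
case: (rev lam) => //= a s; rewrite validP_path -andbA.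
(* Gaps are non-negative, so positivity of the smallest part, first in the reversed list, passes to
   all parts. *)
apply: andb_id2l => a0; apply/andb_idl; elim: s a a0 => //= a' s IH a a0.
move=> /andP[le_aa' /IH]; have a'0 : (0 < a'.1)%N.
  by apply: leq_trans le_aa'; rewrite addn_gt0 a0.
by rewrite a'0; exact.
Qed.

Lemma validF_path a s : validF (nxtF a) s =
  path (fun a a' => okF (nxtF a (fcol a')) a') a s.
Proof. by elim: s a => //= a' s IH a; rewrite -IH. Qed.

Lemma in_F_rev (F : farray n) : in_F F = validF (fun=> (0%N, 0%N)) (rev F).
Proof.
transitivity (sorted (fun a a' => okF (nxtF a (fcol a')) a') (rev F)); last first.
  by case: (rev F) => //= a s; rewrite validF_path.
rewrite /in_F /unzip1 /unzip2 !sorted_map -sorted_relI -{1}[F]revK rev_sorted.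
apply: eq_sorted => -[[u i] [v k]] [[u' i'] [v' k']].
rewrite /a_lt /b_lt /okF /nxtF /=; lia.
Qed.

Lemma P_ker_rev (lam : cpart n) S :
  P_ker lam = S <-> nf (map snd (rev lam)) == rev S.
Proof.
rewrite /P_ker /P_colours -[unzip2 lam]revK reduction_nf /unzip2 -map_rev.
by split=> [<-|/eqP->]; rewrite revK.
Qed.

Lemma F_ker_rev (F : farray n) S :
  F_ker F = S <-> nf (map (@fcol n) (rev F)) == rev S.
Proof.
rewrite /F_ker /F_colours -[X in reduction X]revK reduction_nf -map_rev.
by split=> [<-|/eqP->]; rewrite revK.
Qed.

Lemma P_weight_rev (lam : cpart n) : P_weight lam = (\sum_(a <- rev lam) a.1)%N.
Proof. by apply: perm_big; rewrite perm_sym perm_rev. Qed.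

Lemma F_weight_rev (F : farray n) : F_weight F = (\sum_(a <- rev F) fwt a)%N.
Proof.
rewrite (perm_big F) ?perm_rev // /F_weight !big_map -addnA -big_split /=.
by rewrite -sum1_size -big_split.
Qed.

Lemma sum_ge_entries (T : eqType) (w : T -> nat) s :
  (forall a, a \in s -> 0 < w a)%N ->
  (size s <= \sum_(a <- s) w a)%N /\
  forall a, a \in s -> (w a <= \sum_(a <- s) w a)%N.
Proof.
move=> w0; split.
  by rewrite -sum1_size !big_seq; apply: leq_sum => a; exact: w0.
by move=> a as_; rewrite (big_rem a) //= leq_addr.
Qed.

Lemma om_bigO_P t d c : bigO 0 (@omP n _ qF t.+1 d c).
Proof.
by rewrite /omP -exprM; apply: bigOMl; [exact: bigO0_qF | exact: bigO_inv_one_sub].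
Qed.

Lemma om_bigO_F t d c : bigO 0 (@omF n _ qF t.+1 d c).
Proof.
rewrite /omF -exprM expr2 invfM; apply: bigOMl; first exact: bigO0_qF.
by apply: bigOMl; exact: bigO_inv_one_sub.
Qed.

Lemma box_sum_P N s t :
  bigO N (\sum_(z <- words n t.+1 | nf z == s)
            wweight (omP qF) z * (qF ^+ t.+1 / (1 - qF ^+ t.+1))
    - \sum_(x <- seqs (boxP n N) t.+1 |
          validP (fun=> 1%N) x && (nf (map snd x) == s)) qF ^+ (\sum_(a <- x) a.1)).
Proof.
have nxt_om u (a : nat * colour n) c : (qF ^+ u.+1) ^+ nxtP a c * denP u.+1 =
    (qF ^+ u.+1) ^+ a.1 * omP qF u.+1 c a.2.
  by rewrite /nxtP exprD /omP mulrA.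
rewrite /words sum_seqsS.
have := @box_sum n N _ _ (boxP n N) snd fst (@okP n) (@nxtP n) id (omP qF) denP
  om_bigO_P nxt_om (@geomP n N) t (fun=> 1%N) (fun z => nf z == s).
congr (bigO N (_ - _)).
by apply: eq_bigr => c _; apply: eq_bigr => z _; rewrite mulrAC mulrC expr1.
Qed.

Lemma box_sum_F N s t :
  bigO N (\sum_(z <- words n t.+1 | nf z == s)
            wweight (omF qF) z * (qF ^+ t.+1 / (1 - qF ^+ t.+1) ^+ 2)
    - \sum_(x <- seqs (boxF n N) t.+1 |
          validF (fun=> (0%N, 0%N)) x && (nf (map (@fcol n) x) == s))
        qF ^+ (\sum_(a <- x) fwt a)).
Proof.
have nxt_om u (a : fentry n) c :
    (qF ^+ u.+1) ^+ ((nxtF a c).1 + (nxtF a c).2) * denF u.+1 =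
    (qF ^+ u.+1) ^+ fwt a * omF qF u.+1 c (fcol a).
  rewrite /denF /omF; move: (qF ^+ u.+1) => x.
  rewrite !mulrA -exprSr -exprD; congr (_ ^+ _ / _).
  rewrite /nxtF /fwt /gapF /fcol /=; lia.
rewrite /words sum_seqsS.
have := @box_sum n N _ _ (boxF n N) (@fcol n) (@fwt n) (@okF n) (@nxtF n)
  (fun e => e.1 + e.2)%N (omF qF) denF om_bigO_F nxt_om (@geomF n N) t
  (fun=> (0%N, 0%N)) (fun z => nf z == s).
congr (bigO N (_ - _)).
apply: eq_bigr => c _; apply: eq_bigr => z _.
by rewrite expr0 mul1r.
Qed.

Lemma total_diff_nf s : sorted (@irr n) s -> exists L, forall N,
  bigO N (qF ^+ L * \sum_(t < N)
    (\sum_(z <- words n t.+1 | nf z == s)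
       wweight (omP qF) z * (qF ^+ t.+1 / (1 - qF ^+ t.+1))
   - \sum_(z <- words n t.+1 | nf z == s)
       wweight (omF qF) z * (qF ^+ t.+1 / (1 - qF ^+ t.+1) ^+ 2))).
Proof.
case: s => [_|d r]; last exact: total_diff.
exists 0%N => N; rewrite mul1r big1; first exact: bigO0.
move=> t _; have Z (f : seq (colour n) -> K) :
    \sum_(z <- words n t.+1 | nf z == [::]) f z = 0.
  by rewrite big_seq_cond big1 // => z /andP[/nf_words_nonnil/negPf->].
by rewrite !Z subrr.
Qed.

Definition QP s x := validP (fun=> 1%N) x && (nf (map snd x) == s).
Definition QF s x := validF (fun=> (0%N, 0%N)) x && (nf (map (@fcol n) x) == s).

Lemma count_eq s m : sorted (@irr n) s -> exists2 N, (m < N)%N &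
  (\sum_(p < N.+1) count (fun x => QP s x && ((\sum_(a <- x) a.1)%N == m))
                     (seqs (boxP n N) p) =
   \sum_(p < N.+1) count (fun x => QF s x && ((\sum_(a <- x) fwt a)%N == m))
                     (seqs (boxF n N) p))%N.
Proof.
(* The coefficient of interest is that of $q^{L+m}$ after multiplication by $q^L$, so N must exceed
   L + m. *)
move=> /total_diff_nf[L HL]; exists (L + m).+1; first by rewrite ltnS leq_addl.
set N := (L + m).+1; rewrite !(big_ord_recl N); congr (_ + _)%N.
  by rewrite /= !big_nil.
pose pP t : {poly rat} :=
  \sum_(x <- seqs (boxP n N) t.+1 | QP s x) 'X^(\sum_(a <- x) a.1).
pose pF t : {poly rat} :=
  \sum_(x <- seqs (boxF n N) t.+1 | QF s x) 'X^(\sum_(a <- x) fwt a).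
have : bigO N (FracField.tofrac ('X^L * \sum_(t < N) (pP t - pF t))).
  rewrite rmorphM rmorphXn rmorph_sum -/qF.
  (* The polynomial difference is the difference of the exact generating functions minus the
     truncation errors bounded by [box_sum_P] and [box_sum_F]. *)
  have -> : qF ^+ L * \sum_(t < N) FracField.tofrac (pP t - pF t) =
    qF ^+ L * \sum_(t < N)
    (\sum_(z <- words n t.+1 | nf z == s)
       wweight (omP qF) z * (qF ^+ t.+1 / (1 - qF ^+ t.+1))
   - \sum_(z <- words n t.+1 | nf z == s)
       wweight (omF qF) z * (qF ^+ t.+1 / (1 - qF ^+ t.+1) ^+ 2)) -
    qF ^+ L * \sum_(t < N)
    ((\sum_(z <- words n t.+1 | nf z == s)
       wweight (omP qF) z * (qF ^+ t.+1 / (1 - qF ^+ t.+1))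
       - FracField.tofrac (pP t)) -
     (\sum_(z <- words n t.+1 | nf z == s)
       wweight (omF qF) z * (qF ^+ t.+1 / (1 - qF ^+ t.+1) ^+ 2)
       - FracField.tofrac (pF t))).
    rewrite -mulrBr -sumrB; congr (_ * _); apply: eq_bigr => t _.
    by rewrite rmorphB opprB addrA subrKA opprB addrC subrKA.
  apply: bigOB; first exact: HL.
  apply: bigOMl; first exact: bigO0_qF.
  apply: bigO_sum => t _; apply: bigOB.
    have := box_sum_P N s t; congr (bigO N (_ - _)).
    by rewrite rmorph_sum; apply: eq_bigr => x _; rewrite qFX.
  have := box_sum_F N s t; congr (bigO N (_ - _)).
  by rewrite rmorph_sum; apply: eq_bigr => x _; rewrite qFX.
move=> /bigO_coef H; have := H _ (ltnSn (L + m)).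
rewrite coefXnM ltnNge leq_addr /= addKn coef_sum => {}H.
apply/eqP; rewrite -[_ == _](Num.Theory.eqr_nat rat) !natr_sum -subr_eq0 -sumrB.
rewrite -[X in _ == X]H; apply/eqP; apply: eq_bigr => t _; rewrite coefB !coef_sum_X.
by [].
Qed.

Lemma validP_pos s : validP (fun=> 1%N) s -> forall a, a \in s -> (0 < a.1)%N.
Proof.
move=> vs a as_; have /andP[/allP] : in_P (rev s) by rewrite in_P_rev revK.
by move/(_ a); rewrite mem_rev as_ => ->.
Qed.

Lemma gf_P S m N : (m < N)%N ->
  let X := [set lam : cpart n | in_P lam /\ P_ker lam = S]%classic in
  finite_set [set lam | X lam /\ P_weight lam = m]%classic /\
  gf X (@P_weight n) m = (\sum_(p < N.+1) count (fun x => QP (rev S) x &&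
    ((\sum_(a <- x) a.1)%N == m)) (seqs (boxP n N) p))%N.
Proof.
move=> ltmN; apply: gf_box => [|lam|lam|s /andP[/validP_pos s0 _] ws].
- exact: uniq_boxP.
- by rewrite /QP -in_P_rev /=; split=> [[-> /P_ker_rev]|/andP[-> /P_ker_rev]].
- exact: P_weight_rev.
have [size_s le_s] := sum_ge_entries s0; rewrite ws in size_s le_s.
rewrite (leq_trans size_s (ltnW ltmN)); apply/allP => a as_.
by rewrite /= mem_boxP (leq_ltn_trans (le_s a as_)).
Qed.

Lemma gf_F S m N : (m < N)%N ->
  let X := [set F : farray n | in_F F /\ F_ker F = S]%classic in
  finite_set [set F | X F /\ F_weight F = m]%classic /\
  gf X (@F_weight n) m = (\sum_(p < N.+1) count (fun x => QF (rev S) x &&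
    ((\sum_(a <- x) fwt a)%N == m)) (seqs (boxF n N) p))%N.
Proof.
move=> ltmN; apply: gf_box => [|F|F|s _ ws].
- exact: uniq_boxF.
- by rewrite /QF -in_F_rev /=; split=> [[-> /F_ker_rev]|/andP[-> /F_ker_rev]].
- exact: F_weight_rev.
have [//|size_s le_s] := @sum_ge_entries _ (@fwt n) s; rewrite ws in size_s le_s.
rewrite (leq_trans size_s (ltnW ltmN)); apply/allP => a as_.
have /ltnW ltaN := leq_ltn_trans (le_s a as_) ltmN.
by rewrite /= mem_boxF !(leq_trans _ ltaN) // ltnS ?leq_addr ?leq_addl.
Qed.
End Final.

Theorem theorem3p10 (n : nat) (hn : (0 < n)%N) (S : seq (colour n))
    (hS : reduced S) :
  let PS := [set lam : cpart n | in_P lam /\ P_ker lam = S]%classic in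
  let FS := [set F : farray n | in_F F /\ F_ker F = S]%classic in
  [/\ summable_gf PS (@P_weight n), summable_gf FS (@F_weight n) &
      forall m : nat, gf PS (@P_weight n) m = gf FS (@F_weight n) m].
Proof.
split=> m.
- by have [] := gf_P S (ltnSn m).
- by have [] := gf_F S (ltnSn m).
have [N ltmN E] := count_eq m (reduced_irr hS).
by have [_ ->] := gf_P S ltmN; have [_ ->] := gf_F S ltmN.
Qed.
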